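(* For any positive integers $q,k\geq 1$, \textsc{Maximum Minimal OCT} restricted to input graphs that are $(q,k)$-unbreakable can be solved in time $2^{(qk)^{\mathcal{O}(q)}}\cdot n^{\mathcal{O}(1)}$, where $n$ is the number of vertices of the input graph.
   Context: All graphs are finite, simple and undirected. An oct of $G$ is a set $Z\subseteq V(G)$ with $G-Z$ bipartite; it is minimal if no proper subset is an oct. \textsc{Maximum Minimal OCT}: given $G$ and a positive integer $k$, decide whether $G$ has a minimal oct of size at least $k$. A separation of $G$ is a pair $(X,Y)$ with $X\cup Y=V(G)$ and no edge between $X\setminus Y$ and $Y\setminus X$; its order is $|X\cap Y|$. $G$ is $(q,k)$-breakable if it has a separation of order at most $k$ with $|X\setminus Y|\geq q$ and $|Y\setminus X|\geq q$; otherwise $G$ is $(q,k)$-unbreakable. *)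

(* Defs.v *)
From mathcomp Require Import all_boot.

Set Implicit Arguments.
Unset Strict Implicit.
Unset Printing Implicit Defensive.

Record sgraph (T : finType) := SGraph {
  edge :> rel T;
  edge_sym : symmetric edge;
  edge_irr : irreflexive edge }.

Section Graphs.
Variables (T : finType) (G : sgraph T).

Definition bipartite : Prop :=
  exists f : T -> bool, forall x y, G x y -> f x != f y.

Definition separation (X Y : {set T}) : Prop :=
  X :|: Y = [set: T] /\
  forall x y, x \in X :\: Y -> y \in Y :\: X -> ~~ G x y.

Definition breakable (q k : nat) : Prop :=
  exists X Y : {set T},
    [/\ separation X Y, #|X :&: Y| <= k, q <= #|X :\: Y| & q <= #|Y :\: X|].

Definition unbreakable (q k : nat) : Prop := ~ breakable q k.

Variable Z : {set T}.

Definition del_edge : rel {x : T | x \notin Z} :=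
  fun x y => G (val x) (val y).

Lemma del_edge_sym : symmetric del_edge.
Proof. by move=> x y; apply: edge_sym. Qed.

Lemma del_edge_irr : irreflexive del_edge.
Proof. by move=> x; apply: edge_irr. Qed.

Definition del_vertices : sgraph {x : T | x \notin Z} :=
  SGraph del_edge_sym del_edge_irr.

End Graphs.

Definition oct (T : finType) (G : sgraph T) (Z : {set T}) : Prop :=
  bipartite (del_vertices G Z).

Definition minimal_oct (T : finType) (G : sgraph T) (Z : {set T}) : Prop :=
  oct G Z /\ forall Z' : {set T}, Z' \proper Z -> ~ oct G Z'.

Definition max_min_oct (T : finType) (G : sgraph T) (k : nat) : Prop :=
  exists2 Z : {set T}, minimal_oct G Z & k <= #|Z|.

(* Running times are measured on a random access machine with structured      *)
(* control: memory cells are indexed by nat and hold natural numbers, with    *)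
(* indirect addressing. Every operation has unit cost; multiplication is      *)
(* deliberately not primitive, so that t steps only produce numbers of        *)
(* O(t + input) bits and the model is polynomially equivalent to Turing       *)
(* machines.                                                                  *)
Definition memory := nat -> nat.

Inductive expr :=
| Const of nat
| Read of expr
| Add of expr & expr
| Sub of expr & expr. (* truncated subtraction *)

Fixpoint eval (m : memory) (e : expr) : nat :=
  match e with
  | Const c => c
  | Read a => m (eval m a)
  | Add e1 e2 => eval m e1 + eval m e2
  | Sub e1 e2 => eval m e1 - eval m e2
  end.

Fixpoint expr_cost (e : expr) : nat :=
  match e with
  | Const _ => 1
  | Read a => (expr_cost a).+1
  | Add e1 e2 | Sub e1 e2 => (expr_cost e1 + expr_cost e2).+1
  end.

Inductive cmd :=
| Skip
| Write of expr & expr (* memory cell a := e *)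
| Seq of cmd & cmd
| If of expr & cmd & cmd
| While of expr & cmd.

Definition update (m : memory) (a v : nat) : memory :=
  fun i => if i == a then v else m i.

(* exec c m t m': started on m, c halts after t steps with memory m'.         *)
Inductive exec : cmd -> memory -> nat -> memory -> Prop :=
| exec_skip m : exec Skip m 1 m
| exec_store m a e :
    exec (Write a e) m (expr_cost a + expr_cost e).+1
         (update m (eval m a) (eval m e))
| exec_seq c1 c2 m t1 m1 t2 m2 :
    exec c1 m t1 m1 -> exec c2 m1 t2 m2 -> exec (Seq c1 c2) m (t1 + t2) m2
| exec_if_true e c1 c2 m t m' :
    eval m e != 0 -> exec c1 m t m' ->
    exec (If e c1 c2) m (expr_cost e + t).+1 m'
| exec_if_false e c1 c2 m t m' :
    eval m e = 0 -> exec c2 m t m' ->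
    exec (If e c1 c2) m (expr_cost e + t).+1 m'
| exec_while_false e c m :
    eval m e = 0 -> exec (While e c) m (expr_cost e).+1 m
| exec_while_true e c m t1 m1 t2 m2 :
    eval m e != 0 -> exec c m t1 m1 -> exec (While e c) m1 t2 m2 ->
    exec (While e c) m (expr_cost e + t1 + t2).+1 m2.

(* Cells 0, 1, 2 hold n, k, q; then comes the adjacency matrix in row-major   *)
(* order, and every other cell is 0.                                          *)
Definition input (n : nat) (G : sgraph 'I_n) (k q : nat) : memory :=
  fun i => match i with
  | 0 => n
  | 1 => k
  | 2 => q
  | j.+3 => [exists u : 'I_n, exists v : 'I_n, (j == u * n + v) && G u v]
  end.

Definition accepting (m : memory) : Prop := m 0 != 0.

(* Main.v *)
Require Import Defs.
From mathcomp Require Import all_boot.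
From mathcomp Require Import zify.
From Stdlib Require Import FunctionalExtensionality.

Set Implicit Arguments.
Unset Strict Implicit.
Unset Printing Implicit Defensive.

(** A minimal oct [O] with a 2-colouring of [G - O] is a labelling of the
    vertices by 0, 1 (colours) and 2 (oct). Vertices put back greedily give a
    first minimal oct [S]; suppose [|S| < k]. A move out of a small (size
    [< k]) minimal oct [O] picks [x] in [O] and a colour [a], removes the
    neighbours of [x] coloured [a], gives [x] the colour [a] and minimises
    again. If some minimal oct [O*] has size at least [k], then moves lead from
    [S] to such an oct: put the vertices of [V - O*] back one by one, each next
    to those already put back in its component, so that its neighbours among
    them have one colour; nothing put back is ever removed again, and staying
    small until the end would leave a small oct inside [O*].

    The small minimal octs are too many to be explored one by one, but they are
    almost linearly ordered. Compare two of them with the same trace and the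
    same colours on [S]: the vertices outside [S] that they colour differently
    split into the set [F] where only the first agrees with a fixed colouring
    of [G - S] and the set [F'] where only the second does. Their
    neighbourhoods have total size at most [2k - 2], so unbreakability gives
    [|F| < q] or [|F'| < q]. If moreover both agree with the fixed colouring on
    equally many vertices, then [F] and [F'] both have size at most [q + k],
    and either oct is found from the other by branching over at most
    [2q + 4k] relabellings, each one resolving a conflict created by the
    previous ones. Hence one representative per key (the labels on [S] and this
    number of agreements) suffices: [3^k (n + 1)] representatives and
    [2^O(q + k)] branches from each. *)

(** * Programs with arrays and their translation *)

(* Scalars are the entries 0 of their arrays. [EQ] is the parameter [q],      *)
(* [EA j e] the entry [e] of array [j], and [EAdj e] the entry [e] of the     *)
(* adjacency matrix. [AFor x b c] runs [c] with scalar [x] equal to 0, 1, ... *)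
(* up to, but excluding, the value of scalar [b].                             *)
Inductive aexpr :=
| EC of nat
| EQ
| EA of nat & aexpr
| EAdj of aexpr
| EAdd of aexpr & aexpr
| ESub of aexpr & aexpr
| EEq of aexpr & aexpr
| ELt of aexpr & aexpr
| EAnd of aexpr & aexpr
| ENot of aexpr.

Inductive acmd :=
| ASkip
| AStore of nat & aexpr & aexpr
| ASeq of acmd & acmd
| AIf of aexpr & acmd & acmd
| AFor of nat & nat & acmd.

Definition state := nat -> nat -> nat.

Definition upd1 (f : nat -> nat) (i v : nat) : nat -> nat :=
  fun i' => if i' == i then v else f i'.

Definition upd (s : state) (j : nat) (f : nat -> nat) : state :=
  fun j' => if j' == j then f else s j'.

Lemma upd_eq s j f : upd s j f j = f.
Proof. by rewrite /upd eqxx. Qed.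

Lemma upd_neq s j f j' : j' != j -> upd s j f j' = s j'.
Proof. by rewrite /upd => /negPf ->. Qed.

Lemma upd1_eq f i v : upd1 f i v i = v.
Proof. by rewrite /upd1 eqxx. Qed.

Section Semantics.

Variables (base qv : nat) (inp : nat -> nat).

(* Beyond the adjacency matrix, one reads from the zone of the arrays.        *)
Definition adj_cell (s : state) (i : nat) : nat :=
  if i.+3 < base then inp i else s ((i.+3 - base) %% 64) ((i.+3 - base) %/ 64).

Fixpoint aeval (s : state) (e : aexpr) : nat :=
  match e with
  | EC c => c
  | EQ => qv
  | EA j e => s j (aeval s e)
  | EAdj e => adj_cell s (aeval s e)
  | EAdd a b => aeval s a + aeval s b
  | ESub a b => aeval s a - aeval s b
  | EEq a b => aeval s a == aeval s b
  | ELt a b => aeval s a < aeval s b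
  | EAnd a b => (aeval s a != 0) && (aeval s b != 0)
  | ENot a => aeval s a == 0
  end.

Fixpoint run (c : acmd) (s : state) : state :=
  match c with
  | ASkip => s
  | AStore j i e => upd s j (upd1 (s j) (aeval s i) (aeval s e))
  | ASeq c1 c2 => run c2 (run c1 s)
  | AIf e c1 c2 => if aeval s e != 0 then run c1 s else run c2 s
  | AFor x b c =>
    iter (s b 0) (fun s => let s' := run c s in upd s' x (upd1 (s' x) 0 (s' x 0).+1))
      (upd s x (upd1 (s x) 0 0))
  end.

Fixpoint awrites (c : acmd) : seq nat :=
  match c with
  | ASkip => [::]
  | AStore j _ _ => [:: j]
  | ASeq c1 c2 | AIf _ c1 c2 => awrites c1 ++ awrites c2
  | AFor x _ c => x :: awrites c
  end.

Lemma run_frame c s j : j \notin awrites c -> run c s j = s j.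
Proof.
elim: c s => [|j' i e|c1 IH1 c2 IH2|e c1 IH1 c2 IH2|x b c IH] s //=.
- by rewrite inE => /upd_neq ->.
- by rewrite mem_cat negb_or => /andP[n1 n2]; rewrite IH2 ?IH1.
- by rewrite mem_cat negb_or => /andP[n1 n2]; case: ifP => _; rewrite ?IH2 ?IH1.
rewrite inE negb_or => /andP[n1 n2].
by elim: (s b 0) => [|m IHm] /=; rewrite upd_neq ?IH.
Qed.

Lemma run_seq c1 c2 s : run (ASeq c1 c2) s = run c2 (run c1 s).
Proof. by []. Qed.

Lemma run_if e c1 c2 s :
  run (AIf e c1 c2) s = if aeval s e != 0 then run c1 s else run c2 s.
Proof. by []. Qed.

Lemma run_store j i e s :
  run (AStore j i e) s = upd s j (upd1 (s j) (aeval s i) (aeval s e)).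
Proof. by []. Qed.

(** The number of rounds is fixed at entry. The frame premise lets every round read unwritten arrays
    as they were before the loop. *)
Lemma run_for (I : nat -> state -> Prop) x b c s n :
    s b 0 = n -> x \notin awrites c ->
    I 0 (upd s x (upd1 (s x) 0 0)) ->
    (forall i s1, i < n -> s1 x 0 = i ->
       (forall j, j \notin x :: awrites c -> s1 j = s j) -> I i s1 ->
       I i.+1 (upd (run c s1) x (upd1 (run c s1 x) 0 i.+1))) ->
  I n (run (AFor x b c) s).
Proof.
move=> <- xc I0 IS /=.
set f := (fun s => _); set s0 := upd s x _.
suff H m : m <= s b 0 -> [/\ I m (iter m f s0), iter m f s0 x 0 = m
    & forall j, j \notin x :: awrites c -> iter m f s0 j = s j].
  by have [] := H _ (leqnn _).
elim: m => [|m IHm] hm.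
  split=> //; first by rewrite /= /s0 upd_eq upd1_eq.
  by move=> j; rewrite inE negb_or => /andP[jx _]; rewrite /= /s0 upd_neq.
have [Im xm fm] := IHm (ltnW hm).
have := IS m _ hm xm fm Im.
rewrite /= /f run_frame // xm upd_eq upd1_eq; split=> // j hj.
move: (hj); rewrite inE negb_or => /andP[jx jc].
by rewrite upd_neq // run_frame // fm.
Qed.

(** * Translation into machine code *)

Fixpoint double_expr (d : nat) (e : expr) : expr :=
  if d is d'.+1 then let e' := double_expr d' e in Add e' e' else e.

(** As multiplication is not primitive, [64 * i] is formed by six doublings, a constant factor in
    cost. Cell 1 holds [base - 4]. *)
Definition far_addr (j : nat) (i : expr) : expr :=
  Add (Add (Read (Const 1)) (Const 4)) (Add (double_expr 6 i) (Const j)).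

Definition sign_expr (e : expr) : expr := Defs.Sub (Const 1) (Defs.Sub (Const 1) e).

Fixpoint expr_of (e : aexpr) : expr :=
  match e with
  | EC c => Const c
  | EQ => Read (Const 2)
  | EA j e => Read (far_addr j (expr_of e))
  | EAdj e => Read (Add (Const 3) (expr_of e))
  | EAdd a b => Add (expr_of a) (expr_of b)
  | ESub a b => Defs.Sub (expr_of a) (expr_of b)
  | EEq a b =>
    Defs.Sub (Const 1) (Add (Defs.Sub (expr_of a) (expr_of b)) (Defs.Sub (expr_of b) (expr_of a)))
  | ELt a b => sign_expr (Defs.Sub (expr_of b) (expr_of a))
  | EAnd a b =>
    Defs.Sub (Add (sign_expr (expr_of a)) (sign_expr (expr_of b))) (Const 1)
  | ENot a => Defs.Sub (Const 1) (expr_of a)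
  end.

Definition store_of (j : nat) (i e : aexpr) : cmd :=
  Write (far_addr j (expr_of i)) (expr_of e).

Definition incr_of (x : nat) : cmd :=
  store_of x (EC 0) (EAdd (EA x (EC 0)) (EC 1)).

Definition test_of (x b : nat) : expr :=
  expr_of (ESub (EA b (EC 0)) (EA x (EC 0))).

Fixpoint cmd_of (c : acmd) : cmd :=
  match c with
  | ASkip => Skip
  | AStore j i e => store_of j i e
  | ASeq c1 c2 => Seq (cmd_of c1) (cmd_of c2)
  | AIf e c1 c2 => If (expr_of e) (cmd_of c1) (cmd_of c2)
  | AFor x b c =>
    Seq (store_of x (EC 0) (EC 0)) (While (test_of x b) (Seq (cmd_of c) (incr_of x)))
  end.

Fixpoint wf_expr (e : aexpr) : bool :=
  match e with
  | EC _ | EQ => true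
  | EA j e => (j < 64) && wf_expr e
  | EAdj e | ENot e => wf_expr e
  | EAdd a b | ESub a b | EEq a b | ELt a b | EAnd a b => wf_expr a && wf_expr b
  end.

Fixpoint for_bounds (c : acmd) : seq nat :=
  match c with
  | ASkip | AStore _ _ _ => [::]
  | ASeq c1 c2 | AIf _ c1 c2 => for_bounds c1 ++ for_bounds c2
  | AFor _ b c => b :: for_bounds c
  end.

Fixpoint wf_cmd (c : acmd) : bool :=
  match c with
  | ASkip => true
  | AStore j i e => [&& j < 64, wf_expr i & wf_expr e]
  | ASeq c1 c2 => wf_cmd c1 && wf_cmd c2
  | AIf e c1 c2 => [&& wf_expr e, wf_cmd c1 & wf_cmd c2]
  | AFor x b c => [&& x < 64, b < 64, x != b, x \notin awrites c & wf_cmd c]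
  end.

(* Entry [i] of array [j] is kept in cell [base + (64 * i + j)]; cell 1       *)
(* gives access to [base], and cell 0 is reserved for the final answer.       *)
Definition implements (m : memory) (s : state) : Prop :=
  [/\ m 0 = 0, m 1 + 4 = base, m 2 = qv,
      forall i, i.+3 < base -> m i.+3 = inp i
    & forall j i, j < 64 -> m (base + (64 * i + j)) = s j i].

Lemma eval_double m d e : eval m (double_expr d e) = 2 ^ d * eval m e.
Proof.
elim: d => [|d IH] /=; first by rewrite expn0 mul1n.
by rewrite IH expnS -mulnA mul2n addnn.
Qed.

Lemma eval_far m s j i :
  implements m s -> eval m (far_addr j i) = base + (64 * eval m i + j).
Proof.
by case=> _ m1 _ _ _; rewrite /far_addr -m1;
  have /= := eval_double m 6 i; lia.
Qed.

Lemma eval_expr_of m s e :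
  implements m s -> wf_expr e -> eval m (expr_of e) = aeval s e.
Proof.
move=> ms; elim: e => //=.
- by case: ms.
- move=> j e IH /andP[jlt we].
  apply: (etrans (congr1 m (eval_far j (expr_of e) ms))); rewrite IH //.
  by case: ms => _ _ _ _ ->.
- move=> e IH we; rewrite IH // add3n /adj_cell; case: ifP => hb.
    by case: ms => _ _ _ -> .
  (* An address not below [base] is decoded, by division by 64, into an array and an entry. *)
  case: ms => _ _ _ _ mf; rewrite -mf ?ltn_mod // mulnC -divn_eq.
  by congr m; lia.
- by move=> a IHa b IHb /andP[wa wb]; rewrite IHa ?IHb.
- by move=> a IHa b IHb /andP[wa wb]; rewrite IHa ?IHb.
- by move=> a IHa b IHb /andP[wa wb]; rewrite IHa ?IHb //; case: eqP => /=; lia.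
- by move=> a IHa b IHb /andP[wa wb]; rewrite IHa ?IHb //; case: ltnP => /=; lia.
- move=> a IHa b IHb /andP[wa wb]; rewrite IHa ?IHb //.
  by case: (aeval s a) => [|x]; case: (aeval s b) => [|y] //=; lia.
- by move=> a IHa wa; rewrite IHa //; case: (aeval s a).
Qed.

Lemma exec_store_of m s j i e :
  j < 64 -> wf_expr i -> wf_expr e -> implements m s ->
  exists2 m', exec (store_of j i e) m
      (expr_cost (far_addr j (expr_of i)) + expr_cost (expr_of e)).+1 m'
    & implements m' (upd s j (upd1 (s j) (aeval s i) (aeval s e))).
Proof.
move=> jlt wi we ms; eexists; first exact: exec_store.
rewrite (eval_far _ _ ms) !(eval_expr_of ms) //.
case: (ms) => m0 m1 m2 mi mf; split.
- by rewrite /update; case: eqP => // h; exfalso; lia.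
- by rewrite /update; case: eqP => // h; exfalso; lia.
- by rewrite /update; case: eqP => // h; exfalso; lia.
- by move=> i' hi; rewrite /update; case: eqP => [h|_]; [exfalso; lia|exact: mi].
move=> j' i' hj; rewrite /update /upd /upd1 mf //.
case: (j' =P j) => [->|nj].
  by case: (i' =P _) => [->|ni]; [rewrite eqxx|case: eqP => // h; exfalso; lia].
by case: eqP => // h; exfalso; lia.
Qed.

Definition store_cost (j : nat) (i e : aexpr) : nat :=
  (expr_cost (far_addr j (expr_of i)) + expr_cost (expr_of e)).+1.

Fixpoint size_cost (c : acmd) : nat :=
  match c with
  | ASkip => 1
  | AStore j i e => store_cost j i e
  | ASeq c1 c2 => size_cost c1 + size_cost c2
  | AIf e c1 c2 => (expr_cost (expr_of e) + (size_cost c1 + size_cost c2)).+1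
  | AFor x b c =>
    store_cost x (EC 0) (EC 0) + (expr_cost (test_of x b)).+1 +
    ((expr_cost (test_of x b)).+1 + size_cost c +
       store_cost x (EC 0) (EAdd (EA x (EC 0)) (EC 1)))
  end.

Fixpoint for_depth (c : acmd) : nat :=
  match c with
  | ASkip | AStore _ _ _ => 0
  | ASeq c1 c2 | AIf _ c1 c2 => maxn (for_depth c1) (for_depth c2)
  | AFor _ _ c => (for_depth c).+1
  end.

(* The loop bounds are required to be loop invariants, so that the running    *)
(* time is bounded by the nesting depth alone.                                *)
Lemma exec_cmd_of (X : nat) c m s :
    wf_cmd c -> {in for_bounds c, forall b, b \notin awrites c} ->
    implements m s -> {in for_bounds c, forall b, s b 0 <= X} ->
  exists t m', [/\ exec (cmd_of c) m t m', implements m' (run c s)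
    & t <= size_cost c * X.+1 ^ for_depth c].
Proof.
elim: c m s => [|j i e|c1 IH1 c2 IH2|e c1 IH1 c2 IH2|x b c IH] m s.
- by move=> _ _ ms _; exists 1, m; split=> //; exact: exec_skip.
- move=> /and3P[jlt wi we] _ ms _.
  have [m' h1 h2] := exec_store_of jlt wi we ms.
  by exists (store_cost j i e), m'; split=> //=; rewrite expn0 muln1.
- move=> /= /andP[w1 w2] bw ms bX.
  have hin1 b : b \in for_bounds c1 -> b \in for_bounds c1 ++ for_bounds c2.
    by rewrite mem_cat => ->.
  have hin2 b : b \in for_bounds c2 -> b \in for_bounds c1 ++ for_bounds c2.
    by rewrite mem_cat => ->; rewrite orbT.
  have [||t1 [m1 [e1 r1 l1]]] := IH1 m s w1 _ ms.
  + by move=> b /hin1 /bw; rewrite mem_cat negb_or => /andP[].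
  + by move=> b /hin1 /bX.
  have [||t2 [m2 [e2 r2 l2]]] := IH2 m1 _ w2 _ r1.
  + by move=> b /hin2 /bw; rewrite mem_cat negb_or => /andP[].
  + move=> b /hin2 hb; have := bw _ hb; rewrite mem_cat negb_or => /andP[h _].
    by rewrite run_frame // bX.
  exists (t1 + t2), m2; split=> //; first exact: exec_seq e1 e2.
  rewrite mulnDl leq_add //.
    by apply: leq_trans l1 _; rewrite leq_mul2l leq_pexp2l ?leq_maxl ?orbT.
  by apply: leq_trans l2 _; rewrite leq_mul2l leq_pexp2l ?leq_maxr ?orbT.
- move=> /= /and3P[we w1 w2] bw ms bX.
  have hin1 b : b \in for_bounds c1 -> b \in for_bounds c1 ++ for_bounds c2.
    by rewrite mem_cat => ->.
  have hin2 b : b \in for_bounds c2 -> b \in for_bounds c1 ++ for_bounds c2.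
    by rewrite mem_cat => ->; rewrite orbT.
  have p1 : 0 < X.+1 ^ maxn (for_depth c1) (for_depth c2) by rewrite expn_gt0.
  have pl : X.+1 ^ for_depth c1 <= X.+1 ^ maxn (for_depth c1) (for_depth c2).
    by rewrite leq_pexp2l ?leq_maxl.
  have pr : X.+1 ^ for_depth c2 <= X.+1 ^ maxn (for_depth c1) (for_depth c2).
    by rewrite leq_pexp2l ?leq_maxr.
  case: ifP => he.
    have [||t1 [m1 [e1 r1 l1]]] := IH1 m s w1 _ ms.
    + by move=> b /hin1 /bw; rewrite mem_cat negb_or => /andP[].
    + by move=> b /hin1 /bX.
    exists (expr_cost (expr_of e) + t1).+1, m1; split=> //.
      by apply: exec_if_true e1; rewrite (eval_expr_of ms).
    by nia.
  have [||t1 [m1 [e1 r1 l1]]] := IH2 m s w2 _ ms.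
  + by move=> b /hin2 /bw; rewrite mem_cat negb_or => /andP[].
  + by move=> b /hin2 /bX.
  exists (expr_cost (expr_of e) + t1).+1, m1; split=> //.
    by apply: exec_if_false e1; rewrite (eval_expr_of ms) //; move/eqP: he.
  by nia.
rewrite [wf_cmd _]/= [for_bounds _]/= [awrites _]/= [cmd_of _]/= => /and5P[xlt blt xb xc wc] bw ms bX.
have hc b' : b' \in for_bounds c -> b' \notin awrites c.
  by move=> h; have := bw b'; rewrite !inE h orbT negb_or => /(_ isT) /andP[].
have hx b' : b' \in for_bounds c -> b' != x.
  by move=> h; have := bw b'; rewrite !inE h orbT negb_or => /(_ isT) /andP[].
have bc : b \notin awrites c.
  by have := bw b; rewrite !inE eqxx negb_or => /(_ isT) /andP[].
set N := s b 0; have NX : N <= X by apply: bX; rewrite inE eqxx.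
have [m1 e1 r1] := exec_store_of xlt (isT : wf_expr (EC 0)) (isT : wf_expr (EC 0)) ms.
set f := (fun s : state => let s' := run c s in upd s' x (upd1 (s' x) 0 (s' x 0).+1)).
set s1 := upd s x (upd1 (s x) 0 0).
have {}r1 : implements m1 s1 by [].
have runE : run (AFor x b c) s = iter N f s1 by [].
set E := (expr_cost (test_of x b)).+1.
set J := store_cost x (EC 0) (EAdd (EA x (EC 0)) (EC 1)).
have wt : wf_expr (ESub (EA b (EC 0)) (EA x (EC 0))) by rewrite /= blt xlt.
(* Generalised to a loop with [i] rounds to go, where the counter stands at [N - i]; [E] pays for
   the failing test. *)
suff L i m2 s2 : i <= N -> implements m2 s2 -> s2 b 0 = N -> s2 x 0 = N - i ->
    {in for_bounds c, forall b, s2 b 0 <= X} ->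
    exists t m3, [/\ exec (While (test_of x b) (Seq (cmd_of c) (incr_of x))) m2 t m3,
      implements m3 (iter i f s2) & t <= E + i * (E + size_cost c * X.+1 ^ for_depth c + J)].
  have [|||t [m3 [e3 r3 l3]]] := L N m1 s1 (leqnn N) r1.
  + by rewrite /s1 upd_neq // eq_sym.
  + by rewrite /s1 upd_eq upd1_eq subnn.
  + by move=> b' hb; rewrite /s1 upd_neq ?hx // bX // inE hb orbT.
  exists (store_cost x (EC 0) (EC 0) + t), m3; split; first exact: exec_seq e1 e3.
    by rewrite runE.
  rewrite [for_depth _]/= expnS [size_cost _]/= -/E -/J.
  have : 0 < X.+1 ^ for_depth c by rewrite expn_gt0.
  move: (X.+1 ^ for_depth c) l3 => Y l3 Yp.
  rewrite -addnA mulnDl leq_add //.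
    by apply: leq_pmulr; rewrite muln_gt0.
  apply: leq_trans l3 _; rewrite mulnDl leq_add //.
    by apply: leq_pmulr; rewrite muln_gt0.
  apply: leq_trans (_ : X.+1 * ((E + size_cost c + J) * Y) <= _); last by lia.
  by apply: leq_mul; [lia|rewrite !mulnDl !leq_add //; apply: leq_pmulr].
elim: i m2 s2 => [|i IHi] m2 s2 iN r2 bN xN hX.
  exists E, m2; split=> //.
  apply: exec_while_false; rewrite (eval_expr_of r2) //= bN xN; lia.
have [||t1 [m3 [e3 r3 l3]]] := IH m2 s2 wc _ r2; [by []|by []|].
have wi : wf_expr (EAdd (EA x (EC 0)) (EC 1)) by rewrite /= xlt.
have [m4 e4 r4] := exec_store_of xlt (isT : wf_expr (EC 0)) wi r3.
have xr : run c s2 x 0 = N - i.+1 by rewrite run_frame.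
move: r4; rewrite /= xr addn1 => r4.
have [|||t2 [m5 [e5 r5 l5]]] := IHi m4 _ (ltnW iN) r4.
- by rewrite upd_neq ?run_frame // eq_sym.
- by rewrite upd_eq upd1_eq; lia.
- by move=> b' hb; rewrite upd_neq ?hx // run_frame ?hc // hX.
exists (expr_cost (test_of x b) + (t1 + J) + t2).+1, m5; split.
- apply: exec_while_true e5; last exact: exec_seq e3 e4.
  by rewrite (eval_expr_of r2) //= bN xN; lia.
- by rewrite -[f (iter _ _ _)]/(iter i.+1 f s2) iterSr {2}/f xr.
by rewrite mulSn /E in l5 *; lia.
Qed.

End Semantics.

(** * Labellings and octs *)

Section Labellings.

Variables (T : finType) (G : sgraph T).
Implicit Types (l s r : T -> nat) (Z P H : {set T}) (c : T -> bool).

Definition valid l : Prop :=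
  (forall v, l v <= 2) /\ forall u v, G u v -> l u < 2 -> l u <> l v.

Definition out l : {set T} := [set v | l v == 2].

Definition coloring H c : Prop :=
  forall u v, u \in H -> v \in H -> G u v -> c u != c v.

Lemma coloring_sub H P c : P \subset H -> coloring H c -> coloring P c.
Proof. by move=> /subsetP sub hc u v /sub hu /sub hv; apply: hc. Qed.

Lemma octP Z : oct G Z <-> exists c, coloring (~: Z) c.
Proof.
split=> [[f hf]|[c hc]].
  exists (fun v => if insub v is Some x then f x else false) => u v.
  rewrite !inE => uZ vZ uv; rewrite !insubT.
  exact: (hf (Sub u uZ) (Sub v vZ)).
exists (fun x => c (val x)) => x y xy.
by apply: hc; rewrite ?inE ?(valP x) ?(valP y).
Qed.

Lemma oct_sub Z Z' : Z \subset Z' -> oct G Z -> oct G Z'.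
Proof.
by rewrite -setCS => sub /octP[c hc]; apply/octP; exists c; apply: coloring_sub hc.
Qed.

(** Supersets of octs are octs, so single-vertex deletions are enough to test minimality. *)
Lemma minimal_octI Z :
  oct G Z -> (forall w, w \in Z -> ~ oct G (Z :\ w)) -> minimal_oct G Z.
Proof.
move=> oZ hZ; split=> // Z' /properP[sub [w wZ wZ']] oZ'.
apply: (hZ w wZ); apply: oct_sub oZ'; apply/subsetP => v vZ'.
by rewrite !inE (subsetP sub) // andbT; apply: contraNneq wZ' => <-.
Qed.

Lemma minimal_oct_eq Z Z' : minimal_oct G Z -> oct G Z' -> Z' \subset Z -> Z' = Z.
Proof.
case=> _ hmin oZ' sub; apply/eqP; rewrite eqEsubset sub.
by apply: contraT => nsub; case: (hmin Z') => //; rewrite properE sub nsub.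
Qed.

Lemma valid_coloring l : valid l -> coloring (~: out l) (fun v => l v == 1).
Proof.
case=> l2 hl u v; rewrite !inE => ul vl uv.
have := hl _ _ uv; have := l2 u; have := l2 v.
by case: (l u) ul => [|[|[]]] //; case: (l v) vl => [|[|[]]] // _ _ _ _ /(_ isT).
Qed.

Lemma valid_oct l : valid l -> oct G (out l).
Proof. by move=> /valid_coloring hl; apply/octP; exists (fun v => l v == 1). Qed.

Lemma oct_labelling Z v : oct G Z -> exists l,
  [/\ valid l, out l = Z & v \notin Z -> l v = 0].
Proof.
(* Adding [c v] to all colours exchanges them if necessary, so that [v] gets 0. *)
case/octP=> c hc; exists (fun u => if u \in Z then 2 else c u (+) c v : nat); split.
- split=> [u|u w uw]; first by case: ifP => // _; case: (_ (+) _).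
  case: ifP => // uZ _; case: ifP => [_|wZ]; first by case: (_ (+) _).
  have := hc u w; rewrite !inE uZ wZ => /(_ isT isT uw).
  by case: (c u); case: (c w); case: (c v).
- by apply/setP => u; rewrite inE; case: ifP => // _; case: (_ (+) _).
by move=> /negPf ->; rewrite addbb.
Qed.

(* [l2] is a known labelling and [l1] the one to be reached from it; [dec]    *)
(* marks the vertices whose label has been decided.                           *)
Section Guided.

Variables (l1 l2 : T -> nat).
Hypotheses (p1 : valid l1) (p2 : valid l2).

Definition candidate l (dec : pred T) : pred T :=
  fun y => ~~ dec y &&
    ((l y == 2) || [exists u, [&& dec u, l u == l y & G u y]]).

Definition guided l (dec : pred T) : Prop :=
  forall v, l v = if dec v then l1 v else l2 v.

(** All of [out l1] is counted: a candidate labelled 2 uses up a decision even if it stays in the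
    oct. *)
Definition changes : {set T} := [set v | (l1 v == 2) || (l1 v != l2 v)].

(** The undecided [y] carries its [l2] label. Were this a colour and also its [l1] label, the
    conflict with a decided neighbour would be a conflict of [l1]. *)
Lemma candidate_changes l dec y :
  guided l dec -> candidate l dec y -> y \in changes.
Proof.
move=> g /andP[/negPf ny]; rewrite inE (g y) ny; case: (l1 y =P l2 y); last by rewrite orbT.
move=> <- /orP[->//|/existsP[u /and3P[du]]].
rewrite (g u) du => /eqP uy Guy; rewrite orbF.
have := (proj1 p1) y; rewrite leq_eqVlt => /orP[//|y2].
by case: (proj2 p1 _ _ Guy) => //; rewrite uy.
Qed.

(** Edges between decided vertices are fine by [l1], edges between undecided ones by [l2], and a
    conflict across would leave a candidate. So would an undecided vertex labelled 2, whence the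
    inclusion. *)
Lemma guided_final l dec :
  guided l dec -> (forall y, ~~ candidate l dec y) ->
  valid l /\ out l \subset out l1.
Proof.
move=> g nc; split; first split=> [v|u v uv ul2 luv].
- by rewrite g; case: ifP => _; [apply: (proj1 p1)|apply: (proj1 p2)].
- have := nc v; have := nc u; rewrite /candidate.
  case du: (dec u); case dv: (dec v) => //=.
  + move=> _ _; move: (g u) (g v); rewrite du dv => eu ev.
    by apply: (proj2 p1 _ _ uv); rewrite -?eu -?ev.
  + move=> _; rewrite negb_or => /andP[_ /negP[]].
    by apply/existsP; exists u; rewrite du luv eqxx uv.
  + rewrite negb_or => /andP[_ /negP[]].
    by apply/existsP; exists v; rewrite dv luv eqxx edge_sym uv.
  move=> _ _; move: (g u) (g v); rewrite du dv => eu ev.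
  by apply: (proj2 p2 _ _ uv); rewrite -?eu -?ev.
apply/subsetP => v; rewrite !inE => lv; have := nc v; rewrite /candidate lv andbT negbK.
by move=> dv; move: (g v) lv; rewrite dv => ->.
Qed.

End Guided.

(** * Keys, and closeness of octs with the same key *)

Definition agreement s l : {set T} := [set v | (s v != 2) && (l v == s v)].

Definition same_key s l1 l2 : Prop :=
  (forall v, s v = 2 -> l1 v = l2 v) /\ #|agreement s l1| = #|agreement s l2|.

Definition nbrs (F : {set T}) : {set T} :=
  [set u | (u \notin F) && [exists v in F, G v u]].

(** Otherwise [F :|: nbrs F] and the complement of [F] form a forbidden separation, which meets in
    [nbrs F]. *)
Lemma unbreakable_small (q k : nat) (F F' : {set T}) :
  unbreakable G q k -> #|nbrs F| <= k -> F' \subset ~: (F :|: nbrs F) ->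
  q <= #|F| -> #|F'| < q.
Proof.
move=> unb nk sF' qF; rewrite ltnNge; apply/negP => qF'; apply: unb.
exists (F :|: nbrs F), (~: F); split.
- split; first by apply/setP => v; rewrite !inE; case: (v \in F); rewrite //= orbT.
  move=> x y; rewrite !inE; case xF: (x \in F) => //= _.
  case yF: (y \in F) => //=; rewrite andbT => /existsP h.
  by apply/negP => xy; apply: h; exists x; rewrite xF xy.
- apply: leq_trans nk; apply/subset_leq_card/subsetP => v.
  by rewrite !inE; case: (v \in F) => //=; rewrite andbT.
- apply: leq_trans qF _; apply/subset_leq_card/subsetP => v vF.
  by rewrite !inE vF.
- apply: leq_trans qF' _; apply/subset_leq_card/subsetP => v /(subsetP sF').
  by rewrite !inE; case: (v \in F) => //=; rewrite andbT.
Qed.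

(* The vertices outside [out s] where [l1] and [l2] disagree split into two   *)
(* mutually non-adjacent sets, according to which of them agrees with [s].    *)
(* As [l1] and [l2] coincide on [out s], their neighbourhoods lie in the two  *)
(* transversals and share only common elements of them, hence one of the two  *)
(* has size at most [k] and unbreakability makes one of the two sets small.   *)
Lemma close_of_same_key (q k : nat) s l1 l2 :
  unbreakable G q k -> valid s -> valid l1 -> valid l2 ->
  #|out l1| < k -> #|out l2| < k -> same_key s l1 l2 ->
  #|changes l1 l2| <= 4 * k + 2 * q.
Proof.
move=> unb ps p1 p2 o1 o2 [key eqA].
pose D l l' := [set v | [&& s v != 2, l v == s v, l' v != s v & l' v != 2]].
have bool3 l v : valid l -> [\/ l v = 0, l v = 1 | l v = 2].
  case=> h _; case: (l v) (h v) => [|[|[|x]]] hx;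
    by [exact: Or31|exact: Or32|exact: Or33|].
(* By enumeration of labels. A neighbour of [v] in [out s] has one label in both [l] and [l'] and
   must avoid both colours, so it is 2; elsewhere, along the edge, [l] keeps following [s] and [l']
   keeps opposing it unless the label is 2. *)
have nbF l l' : valid l -> valid l' -> (forall v, s v = 2 -> l v = l' v) ->
    forall u v, s v != 2 -> l v = s v -> l' v != s v -> l' v != 2 -> G v u ->
    [/\ s u = 2 -> (l u == 2) && (l' u == 2),
        s u != 2 -> l u != 2 -> l u = s u
      & s u != 2 -> l' u != 2 -> l' u != s u].
  move=> pl pl' kl u v sv lv l'v l'v2 vu.
  have := kl u; have := proj2 ps _ _ vu; have := proj2 pl _ _ vu.
  have := proj2 pl' _ _ vu; move: sv lv l'v l'v2.
  case: (bool3 s u ps) => ->; case: (bool3 s v ps) => ->;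
    case: (bool3 l u pl) => ->; case: (bool3 l v pl) => ->;
    case: (bool3 l' u pl') => ->; case: (bool3 l' v pl') => -> //=;
    (try by move=> *; split); intuition discriminate.
have nbD l l' : valid l -> valid l' -> (forall v, s v = 2 -> l v = l' v) ->
    forall u, u \in nbrs (D l l') ->
    [/\ (l u == 2) || (l' u == 2), s u = 2 -> (l u == 2) && (l' u == 2),
        s u != 2 -> l u != 2 -> l u = s u
      & s u != 2 -> l' u != 2 -> l' u != s u].
  move=> pl pl' kl u; rewrite !inE => /andP[nF /existsP[v]].
  rewrite !inE => /andP[/and4P[h1 /eqP h2 h3 h4] vu].
  have [A B C] := nbF _ _ pl pl' kl u v h1 h2 h3 h4 vu; split=> //.
  case: (s u =P 2) => [/A/andP[->]//|/eqP su].
  apply: contraT; rewrite negb_or => /andP[n1 n2].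
  by rewrite su (B su n1) eqxx (C su n2) n2 in nF.
have key' v : s v = 2 -> l2 v = l1 v by move=> /key.
pose F := D l1 l2; pose F' := D l2 l1.
have N1 := nbD _ _ p1 p2 key; have N2 := nbD _ _ p2 p1 key'.
have card_sum : #|nbrs F| + #|nbrs F'| <= #|out l1| + #|out l2|.
  rewrite -cardsUI -[X in _ <= X]cardsUI leq_add //; apply/subset_leq_card/subsetP => u.
    by rewrite inE => /orP[/N1|/N2] [h _ _ _]; rewrite !inE // orbC.
  rewrite inE => /andP[/N1[_ A1 B1 C1] /N2[_ A2 B2 C2]]; rewrite !inE.
  case: (s u =P 2) => [/A1//|/eqP su].
  apply/andP; split; apply: contraT => n.
    by move: (C2 su n); rewrite (B1 su n) eqxx.
  by move: (C1 su n); rewrite (B2 su n) eqxx.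
have disj : F' \subset ~: (F :|: nbrs F) /\ F \subset ~: (F' :|: nbrs F').
  split; apply/subsetP => v; rewrite inE => /and4P[h1 /eqP h2 h3 h4];
    rewrite inE inE negb_or; apply/andP; split.
  - by rewrite inE h2 eqxx !andbF.
  - by apply/negP => /N1[]; rewrite h2 (negPf h1) (negPf h4).
  - by rewrite inE h2 eqxx !andbF.
  - by apply/negP => /N2[]; rewrite h2 (negPf h1) (negPf h4).
have small : #|F| < q \/ #|F'| < q.
  have hF := unbreakable_small unb _ (proj1 disj).
  have hF' := unbreakable_small unb _ (proj2 disj).
  by lia.
(* Equal numbers of agreements make the two differences equally large. Each contains one of [F],
   [F'] and exceeds it only by oct vertices, so when one of these sets has fewer than [q] elements,
   the other has fewer than [q + k]. *)
have dA : #|agreement s l1 :\: agreement s l2| = #|agreement s l2 :\: agreement s l1|.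
  by have := cardsID (agreement s l2) (agreement s l1);
     have := cardsID (agreement s l1) (agreement s l2); rewrite setIC; lia.
have subF : F \subset agreement s l1 :\: agreement s l2.
  by apply/subsetP => v; rewrite !inE => /and4P[-> -> /negPf ->].
have subF' : F' \subset agreement s l2 :\: agreement s l1.
  by apply/subsetP => v; rewrite !inE => /and4P[-> -> /negPf ->].
have supF : agreement s l1 :\: agreement s l2 \subset F :|: out l2.
  apply/subsetP => v; rewrite !inE; case: (s v == 2) => //=.
  by case: (l2 v == s v) => //= ->; case: (l2 v == 2).
have supF' : agreement s l2 :\: agreement s l1 \subset F' :|: out l1.
  apply/subsetP => v; rewrite !inE; case: (s v == 2) => //=.
  by case: (l1 v == s v) => //= ->; case: (l1 v == 2).
have := subset_leq_card subF; have := subset_leq_card subF'.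
have := subset_leq_card supF; have := subset_leq_card supF'.
have u1 := cardsU F (out l2); have u2 := cardsU F' (out l1).
have : changes l1 l2 \subset F :|: F' :|: out l1 :|: out l2.
  apply/subsetP => v; rewrite !inE; move: (key v).
  case: (bool3 s v ps) => ->; case: (bool3 l1 v p1) => ->;
    by case: (bool3 l2 v p2) => -> //= /(_ erefl).
move=> /subset_leq_card; rewrite !cardsU; lia.
Qed.

(** A key consists of labels in ['I_3] on the fewer than [k] vertices of [out s] and of a count
    between 0 and [#|T|]. *)
Lemma key_bound k s m (f : nat -> T -> nat) :
  #|out s| < k -> (forall (r : nat) v, r < m -> f r v <= 2) ->
  (forall r r' : nat, r < r' -> r' < m -> ~ same_key s (f r) (f r')) ->
  m <= 3 ^ k * #|T|.+1.
Proof.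
move=> sk f2 inj_f.
pose g (r : 'I_m) : {ffun {v | v \in out s} -> 'I_3} * 'I_#|T|.+1 :=
  ([ffun x => inord (f r (val x))], inord #|agreement s (f r)|).
have key (r r' : 'I_m) : g r = g r' -> same_key s (f r) (f r').
  case=> /ffunP e1 e2; split=> [v sv|]; last first.
    by move: e2 => /(congr1 val) /=; rewrite !inordK // ltnS max_card.
  have vs : v \in out s by rewrite inE sv.
  have := e1 (Sub v vs); rewrite !ffunE => /(congr1 val) /=.
  by rewrite !inordK // ltnS f2.
have gI : injective g.
  move=> r r' e; apply: val_inj; apply/eqP; case: ltngtP => // lt.
    by case: (inj_f _ _ lt (ltn_ord r')); apply: key.
  by case: (inj_f _ _ lt (ltn_ord r)); apply: key.
have := leq_card g gI; rewrite card_ord card_prod card_ffun !card_ord card_sig.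
move=> h; apply: leq_trans h _; rewrite leq_mul2r leq_pexp2l ?orbT //.
by apply: leq_trans (ltnW sk); apply: eq_leq; apply: eq_card => v; rewrite !inE.
Qed.

(* Stands for: vertices of [P] connected within [H] are connected within [P]. *)
(* The colours of the vertices of [P] adjacent to a vertex of [H] are then    *)
(* equal in every colouring of [P], whatever the rest of [H] looks like.      *)
Definition rigid H P : Prop :=
  P \subset H /\ forall a b e, a \in P -> b \in P ->
    (forall c, coloring H c -> c a (+) c b = e) ->
    forall c, coloring P c -> c a (+) c b = e.

Lemma rigid0 H : rigid H set0.
Proof. by split=> [|a b e]; rewrite ?sub0set ?inE. Qed.

(** A vertex of [H] outside [P] with a neighbour in [P] can be added, its colour being forced by
    that neighbour. If there is none, [P] is a union of components of [H], and any other vertex of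
    [H] can be added. *)
Lemma rigid_extend H P c0 :
  coloring H c0 -> rigid H P -> P != H ->
  exists2 x, x \in H :\: P & rigid H (x |: P).
Proof.
move=> hc0 [PH rP] neq.
have colP x c : coloring (x |: P) c -> coloring P c.
  by apply: coloring_sub; apply: subsetUr.
have subx x : x \in H -> x |: P \subset H by move=> xH; rewrite subUset sub1set xH.
have addbI (a b : bool) : a != b -> a = ~~ b by case: a; case: b.
case: (pickP [pred x | (x \in H :\: P) && [exists p in P, G p x]]) => [x /andP[xHP]|none].
  case/existsP=> p /andP[pP px]; exists x => //.
  have xH : x \in H by move: xHP; rewrite inE => /andP[].
  split; first exact: subx.
  have flipx c : coloring (x |: P) c -> c x = ~~ c p.
    by move=> hc; apply: addbI; apply: hc; rewrite ?inE ?eqxx ?pP ?orbT // edge_sym.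
  have flipH c : coloring H c -> c x = ~~ c p.
    by move=> hc; apply: flipx; apply: coloring_sub hc; apply: subx.
  have one b e : b \in P -> (forall c, coloring H c -> c x (+) c b = e) ->
      forall c, coloring (x |: P) c -> c x (+) c b = e.
    move=> bP hb c hc; rewrite flipx // addNb.
    rewrite (rP p b (~~ e) pP bP _ c (colP _ _ hc)) ?negbK // => c' hc'.
    by rewrite -(hb c' hc') flipH // addNb negbK.
  move=> a b e; rewrite !inE => /orP[/eqP->|aP] /orP[/eqP->|bP] hab c hc.
  - by have := hab c0 hc0; rewrite !addbb.
  - exact: (one b e bP hab c hc).
  - by rewrite addbC; apply: (one a e aP _ c hc) => c' hc'; rewrite addbC hab.
  exact: (rP a b e aP bP hab c (colP _ _ hc)).
have [x xHP] : exists x, x \in H :\: P.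
  by apply/set0Pn; rewrite setD_eq0; apply: contra neq => HP; rewrite eqEsubset PH.
exists x => //.
have [xP xH] : x \notin P /\ x \in H by move: xHP; rewrite inE => /andP[].
split; first exact: subx.
(* Flipping [c0] on [P] alone gives another colouring of [H], so no relation between [x] and a
   vertex of [P] holds in all colourings. *)
have flip : coloring H (fun v => (v \in P) (+) c0 v).
  move=> u v uH vH uv; have := hc0 _ _ uH vH uv.
  case uP: (u \in P); case vP: (v \in P) => //=.
  - by case: (c0 u); case: (c0 v).
  - move=> _; have := none v; rewrite /= inE vP vH /= => /negbT/negP[].
    by apply/existsP; exists u; rewrite uP.
  - move=> _; have := none u; rewrite /= inE uP uH /= => /negbT/negP[].
    by apply/existsP; exists v; rewrite vP edge_sym.
have free b e : b \in P -> ~ (forall c, coloring H c -> c x (+) c b = e).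
  move=> bP hb; have := hb _ flip; rewrite -(hb _ hc0) bP (negPf xP).
  by case: (c0 x); case: (c0 b).
move=> a b e; rewrite !inE => /orP[/eqP->|aP] /orP[/eqP->|bP] hab c hc.
- by have := hab c0 hc0; rewrite !addbb.
- by case: (free b e bP).
- by case: (free a e aP) => c' hc'; rewrite addbC hab.
exact: (rP a b e aP bP hab c (colP _ _ hc)).
Qed.

(** In a colouring of [H], the neighbours of [x] all have the colour opposite to [x]. Rigidity
    transfers the equality of those in [P] to [l], which need not colour all of [H]. *)
Lemma rigid_neighbours H P l x c0 :
  coloring H c0 -> rigid H P -> x \in H -> valid l -> P \subset ~: out l ->
  exists2 a, a < 2 & forall v, v \in P -> G x v -> l v != a.
Proof.
move=> hc0 [PH rP] xH pl Pl.
have cl : coloring P (fun v => l v == 1).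
  exact: coloring_sub Pl (valid_coloring pl).
case: (pickP [pred v | (v \in P) && G x v]) => [w /andP[wP xw]|none]; last first.
  by exists 0 => // v vP xv; have := none v; rewrite /= vP xv.
have lP v : v \in P -> l v != 2 by move=> /(subsetP Pl); rewrite !inE.
have same v : v \in P -> G x v -> (l w == 1) = (l v == 1).
  move=> vP xv.
  have e0 : forall c, coloring H c -> c w (+) c v = false.
    move=> c hc; have := hc _ _ xH (subsetP PH _ wP) xw.
    have := hc _ _ xH (subsetP PH _ vP) xv.
    by case: (c w); case: (c v); case: (c x).
  by have := rP w v false wP vP e0 _ cl; case: (l w == 1); case: (l v == 1).
have l2 v := proj1 pl v.
exists (1 - l w) => [|v vP xv]; first by lia.
have := same v vP xv; have := lP _ vP; have := lP _ wP; have := l2 w; have := l2 v.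
by case: (l w) => [|[|[]]] //; case: (l v) => [|[|[]]].
Qed.

(** * Moves between small minimal octs *)

Definition good k l : Prop := [/\ valid l, minimal_oct G (out l) & #|out l| < k].

Definition swap_of l x a l' : Prop :=
  out l' \subset (out l :\ x) :|: [set v | G x v && (l v == a)].

(** The labelling given by [step] has the oct of [l1] but perhaps other colours. This is harmless:
    the induction, on the vertices outside [O] still to be put back, only remembers that [P] avoids
    the current oct. *)
Lemma no_large_minimal_oct k s (rep : (T -> nat) -> Prop) :
  let covered l := exists2 r, rep r & same_key s r l in
  (exists2 l, good k l & covered l) ->
  (forall r l1, rep r -> good k l1 -> same_key s r l1 ->
    exists l, [/\ valid l, out l = out l1 &
      forall x a, x \in out l -> a < 2 ->
        exists l', [/\ good k l', swap_of l x a l' & covered l']]) ->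
  ~ max_min_oct G k.
Proof.
move=> covered start step [O minO kO].
have [c0 hc0] := (octP O).1 (proj1 minO).
have main m P l1 : #|~: O :\: P| <= m -> rigid (~: O) P -> good k l1 ->
    covered l1 -> P \subset ~: out l1 -> False.
  elim: m P l1 => [|m IHm] P l1 hm rP g1 c1 Pl1.
    (* All vertices outside [O] are back: the oct lies inside [O], so equals it by minimality, but
       is too small. *)
    have PO : ~: O \subset P by rewrite -setD_eq0 -cards_eq0 -leqn0.
    have sub : out l1 \subset O by rewrite -setCS; apply: subset_trans PO Pl1.
    case: g1 => p1 min1 sm1.
    have := minimal_oct_eq minO (proj1 min1) sub => e.
    by move: sm1; rewrite e ltnNge kO.
  have [PO|neq] := eqVneq P (~: O).
    by apply: (IHm P l1) => //; rewrite PO setDv cards0.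
  have [x xOP rxP] := rigid_extend hc0 rP neq.
  have dec : #|~: O :\: (x |: P)| <= m.
    rewrite -ltnS; apply: leq_trans hm; apply: proper_card.
    apply/properP; split; first by apply: setDS; apply: subsetUr.
    by exists x => //; rewrite !inE eqxx.
  have [xP xO] : x \notin P /\ x \in ~: O by move: xOP; rewrite inE => /andP[].
  case: (boolP (x \in out l1)) => xl1; last first.
    by apply: (IHm (x |: P) l1) => //; rewrite subUset sub1set inE xl1.
  have [r rr key] := c1.
  have [l [pl ol hl]] := step r l1 rr g1 key.
  (* The colour is chosen with respect to [l], where the move takes place; it then removes no vertex
     of [P]. *)
  have [a a2 ha] : exists2 a, a < 2 & forall v, v \in P -> G x v -> l v != a.
    by apply: rigid_neighbours hc0 rP xO pl _; rewrite ol.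
  have [|l' [g' sw c']] := hl x a _ a2; first by rewrite ol.
  apply: (IHm (x |: P) l') => //.
  apply/subsetP => v vxP; rewrite inE; apply/negP => /(subsetP sw).
  move: vxP; rewrite !inE => /orP[/eqP->|vP].
    by rewrite eqxx edge_irr.
  case/orP=> [/andP[_]|/andP[xv]]; last by apply/negP; apply: ha.
  by move: (subsetP Pl1 _ vP); rewrite -ol !inE => /negPf ->.
have [l gl cl] := start.
by apply: (main #|~: O :\: set0| set0 l) => //; [exact: rigid0|rewrite sub0set].
Qed.

End Labellings.

(** * The search program *)

Arguments run : simpl never.
Arguments upd s j f j' /.
Arguments upd1 f i v i' /.

(* [aLab] and [aDec]: labelling under construction and its decided vertices;  *)
(* [aCur]: labelling being minimised; [aSaved]: minimal oct being left;       *)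
(* [aBase]: labelling of the first minimal oct; [aRep]: table of the [aNrep]  *)
(* representatives, with [aEnd] its first free entry and [aOff], [aOff2] the  *)
(* positions of the current representatives; [aPow], [aQuo], [aRem]: 3 to the *)
(* number [aD] of branching steps, and division by 3 below it.                *)
Notation aN := 0 (only parsing).
Notation aK := 1 (only parsing).
Notation aNN := 2 (only parsing).
Notation aRow := 3 (only parsing).
Notation aD := 4 (only parsing).
Notation aPow := 5 (only parsing).
Notation aMax := 6 (only parsing).
Notation aQuo := 7 (only parsing).
Notation aRem := 8 (only parsing).
Notation aTwo := 9 (only parsing).
Notation aLab := 10 (only parsing).
Notation aDec := 11 (only parsing).
Notation aY := 12 (only parsing).
Notation aFlag := 13 (only parsing).
Notation aCnt := 14 (only parsing).
Notation aCur := 15 (only parsing).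
Notation aSaved := 16 (only parsing).
Notation aBase := 17 (only parsing).
Notation aRep := 18 (only parsing).
Notation aNrep := 19 (only parsing).
Notation aEnd := 20 (only parsing).
Notation aOff := 21 (only parsing).
Notation aAns := 22 (only parsing).
Notation aCode := 23 (only parsing).
Notation aOff2 := 24 (only parsing).
Notation aFound := 25 (only parsing).
Notation aEq := 26 (only parsing).
Notation aC1 := 27 (only parsing).
Notation aC2 := 28 (only parsing).
Notation aI := 31 (only parsing).
Notation aJ := 32 (only parsing).
Notation aT := 33 (only parsing).
Notation aV := 34 (only parsing).
Notation aX := 35 (only parsing).
Notation aA := 36 (only parsing).
Notation aE := 37 (only parsing).
Notation aR := 38 (only parsing).
Notation aR2 := 39 (only parsing).

Notation EV j := (EA j (EC 0)).
Notation ASet j e := (AStore j (EC 0) e).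
Notation AWhen e c := (AIf e c ASkip).
Notation EAdjacent u v := (EAdj (EAdd (EA aRow u) v)).
Infix ";;" := ASeq (at level 60, right associativity).

(** Later hits overwrite earlier ones, so the largest candidate survives; the value [n] means that
    there is none. *)
Definition pick_cmd : acmd :=
  ASet aY (EV aN) ;;
  AFor aI aN
    (AWhen (ENot (EA aDec (EV aI)))
      (AIf (EEq (EA aLab (EV aI)) (EC 2)) (ASet aY (EV aI))
        (AFor aJ aN
          (AWhen (EAnd (EA aDec (EV aJ))
                   (EAnd (EEq (EA aLab (EV aJ)) (EA aLab (EV aI)))
                     (EAdjacent (EV aJ) (EV aI))))
            (ASet aY (EV aI)))))).

Definition decide_cmd (e : aexpr) : acmd :=
  AWhen (ELt (EV aY) (EV aN)) (AStore aLab (EV aY) e ;; AStore aDec (EV aY) (EC 1)).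

Definition check_cmd : acmd :=
  ASet aFlag (EC 1) ;;
  AFor aI aN
    (AFor aJ aN
      (AWhen (EAnd (EAdjacent (EV aI) (EV aJ))
               (EAnd (ELt (EA aLab (EV aI)) (EC 2))
                 (EEq (EA aLab (EV aI)) (EA aLab (EV aJ)))))
        (ASet aFlag (EC 0)))).

Definition count_cmd (a : nat) : acmd :=
  ASet aCnt (EC 0) ;;
  AFor aI aN (AWhen (EEq (EA a (EV aI)) (EC 2)) (ASet aCnt (EAdd (EV aCnt) (EC 1)))).

Definition copy_cmd (a b : nat) : acmd := AFor aI aN (AStore b (EV aI) (EA a (EV aI))).

Definition propagate_cmd : acmd :=
  AFor aT aN (pick_cmd ;; decide_cmd (ESub (EC 1) (EA aLab (EV aY)))).

(** Oct vertices count as decided, so that only colours propagate. Trying the colour 0 alone loses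
    nothing, by symmetry of the colours. *)
Definition extend_cmd : acmd :=
  AFor aV aN
    (AWhen (EEq (EA aCur (EV aV)) (EC 2))
      (AFor aI aN
         (AStore aLab (EV aI) (EA aCur (EV aI)) ;;
          AStore aDec (EV aI) (EEq (EA aCur (EV aI)) (EC 2))) ;;
       AStore aLab (EV aV) (EC 0) ;;
       propagate_cmd ;;
       check_cmd ;;
       AWhen (EV aFlag) (copy_cmd aLab aCur))).

Definition load_cmd : acmd :=
  AFor aI aN
    (AStore aLab (EV aI) (EA aRep (EAdd (EV aOff) (EV aI))) ;;
     AStore aDec (EV aI) (EC 0)).

(** [aE] encodes in base 3 the labels to be given to successive candidates, the first label being
    the lowest digit. *)
Definition explore_cmd : acmd :=
  ASet aCode (EV aE) ;;
  AFor aT aD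
    (pick_cmd ;; decide_cmd (EA aRem (EV aCode)) ;; ASet aCode (EA aQuo (EV aCode))).

Definition swap_cmd : acmd :=
  AFor aI aN
    (AIf (EAnd (EAdjacent (EV aX) (EV aI)) (EEq (EA aSaved (EV aI)) (EV aA)))
      (AStore aCur (EV aI) (EC 2))
      (AStore aCur (EV aI) (EA aSaved (EV aI)))) ;;
  AStore aCur (EV aX) (EV aA).

Definition compare_cmd : acmd :=
  ASet aEq (EC 1) ;; ASet aC1 (EC 0) ;; ASet aC2 (EC 0) ;;
  AFor aI aN
    (AIf (EEq (EA aBase (EV aI)) (EC 2))
      (AWhen (ENot (EEq (EA aRep (EAdd (EV aOff2) (EV aI))) (EA aCur (EV aI))))
        (ASet aEq (EC 0)))
      (AWhen (EEq (EA aRep (EAdd (EV aOff2) (EV aI))) (EA aBase (EV aI)))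
         (ASet aC1 (EAdd (EV aC1) (EC 1))) ;;
       AWhen (EEq (EA aCur (EV aI)) (EA aBase (EV aI)))
         (ASet aC2 (EAdd (EV aC2) (EC 1))))).

(** The main loop writes [aNrep], which therefore cannot bound a loop; [aMax] does, and the guard
    skips missing entries. *)
Definition lookup_cmd : acmd :=
  ASet aFound (EC 0) ;; ASet aOff2 (EC 0) ;;
  AFor aR2 aMax
    (AWhen (ELt (EV aR2) (EV aNrep))
       (compare_cmd ;;
        AWhen (EAnd (EV aEq) (EEq (EV aC1) (EV aC2))) (ASet aFound (EC 1))) ;;
     ASet aOff2 (EAdd (EV aOff2) (EV aN))).

Definition insert_cmd : acmd :=
  AFor aI aN (AStore aRep (EAdd (EV aEnd) (EV aI)) (EA aCur (EV aI))) ;;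
  ASet aEnd (EAdd (EV aEnd) (EV aN)) ;;
  ASet aNrep (EAdd (EV aNrep) (EC 1)).

Definition record_cmd : acmd :=
  count_cmd aCur ;;
  AIf (ELt (EV aCnt) (EV aK))
    (lookup_cmd ;; AWhen (ENot (EV aFound)) insert_cmd)
    (ASet aAns (EC 1)).

Definition expand_cmd : acmd :=
  load_cmd ;; explore_cmd ;; check_cmd ;; count_cmd aLab ;;
  AWhen (EAnd (EV aFlag) (ELt (EV aCnt) (EV aK)))
    (copy_cmd aLab aSaved ;;
     AFor aX aN
       (AWhen (EEq (EA aSaved (EV aX)) (EC 2))
         (AFor aA aTwo (swap_cmd ;; extend_cmd ;; record_cmd)))).

(** Representatives found on the way are appended behind the current one, so a single pass over the
    growing table expands them all. *)
Definition main_cmd : acmd :=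
  AFor aI aN (AStore aCur (EV aI) (EC 2)) ;;
  extend_cmd ;; copy_cmd aCur aBase ;; record_cmd ;;
  AFor aR aMax
    (AWhen (ELt (EV aR) (EV aNrep)) (AFor aE aPow expand_cmd) ;;
     ASet aOff (EAdd (EV aOff) (EV aN))).

(** * Loop results as bounded quantifiers, counts and last hits *)

Section OrdinalLoops.

Variable n : nat.
Implicit Types P : pred 'I_n.

Lemma exists_ltS P i (hi : i < n) :
  [exists u : 'I_n, (u < i.+1) && P u] = [exists u : 'I_n, (u < i) && P u] || P (Ordinal hi).
Proof.
apply/existsP/orP => [[u /andP[]]|[/existsP[u /andP[ui Pu]]|Pi]].
- rewrite ltnS leq_eqVlt => /orP[/eqP ui Pu|ui Pu].
    by right; rewrite (_ : Ordinal hi = u) //; apply: val_inj.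
  by left; apply/existsP; exists u; rewrite ui.
- by exists u; rewrite ltnS ltnW.
by exists (Ordinal hi); rewrite ltnS leqnn.
Qed.

Lemma exists_lt0 P : [exists u : 'I_n, (u < 0) && P u] = false.
Proof. by apply/existsP => -[]. Qed.

Lemma exists_ltn P : [exists u : 'I_n, (u < n) && P u] = [exists u, P u].
Proof. by apply: eq_existsb => u; rewrite ltn_ord. Qed.

Lemma card_ltS P i (hi : i < n) :
  #|[set u : 'I_n | (u < i.+1) && P u]| =
  #|[set u : 'I_n | (u < i) && P u]| + P (Ordinal hi).
Proof.
case Pi: (P (Ordinal hi)); last first.
  rewrite addn0; apply: eq_card => u; rewrite !inE ltnS leq_eqVlt.
  case: eqP => //= ui; rewrite ui ltnn /=.
  by rewrite (_ : u = Ordinal hi) //; apply: val_inj.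
rewrite addn1 (cardsD1 (Ordinal hi)) !inE ltnS leqnn Pi /= add1n; congr _.+1.
apply: eq_card => u; rewrite !inE -val_eqE /= ltnS leq_eqVlt.
by case: eqP => //= ->; rewrite ltnn.
Qed.

Lemma card_lt0 P : #|[set u : 'I_n | (u < 0) && P u]| = 0.
Proof. by apply/eqP; rewrite cards_eq0; apply/eqP/setP => u; rewrite !inE. Qed.

Lemma card_ltn P : #|[set u : 'I_n | (u < n) && P u]| = #|[set u | P u]|.
Proof. by apply: eq_card => u; rewrite !inE ltn_ord. Qed.

Fixpoint last_true P (i : nat) : nat :=
  if i is i'.+1 then
    if insub i' is Some y then if P y then i' else last_true P i' else last_true P i'
  else n.

Lemma last_trueS P i (hi : i < n) :
  last_true P i.+1 = if P (Ordinal hi) then i else last_true P i.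
Proof. by rewrite /= insubT. Qed.

Lemma last_trueP P :
  (exists2 y : 'I_n, last_true P n = y & P y) \/
  last_true P n = n /\ forall y, ~~ P y.
Proof.
suff H i : i <= n -> (exists2 y : 'I_n, last_true P i = y & P y) \/
    last_true P i = n /\ forall y : 'I_n, y < i -> ~~ P y.
  by case: (H n (leqnn n)) => [|[e h]]; [left|right; split=> // y; apply: h].
elim: i => [|i IHi] hi; first by right.
rewrite (last_trueS P hi); case: ifP => Pi; first by left; exists (Ordinal hi).
case: (IHi (ltnW hi)) => [|[e h]]; first by left.
right; split=> // y; rewrite ltnS leq_eqVlt => /orP[/eqP yi|]; last exact: h.
by rewrite (_ : y = Ordinal hi) ?Pi //; apply: val_inj.
Qed.

End OrdinalLoops.

(** * Correctness of the search *)

Section Program.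

Variables (base q k n : nat) (inp : nat -> nat) (G : sgraph 'I_n).
Hypothesis inpE : forall u v : 'I_n, inp (u * n + v) = G u v.
Hypothesis base_gt : n * n + 3 <= base.

Local Notation run := (run base q inp).
Local Notation aeval := (aeval base q inp).
Local Notation depth := (4 * k + 2 * q + 1).
Implicit Types s : state.

(** For invariants insensitive to the counter, which need not follow its increments. *)
Lemma run_forI (I : nat -> state -> Prop) x b c s m :
    s b 0 = m -> x \notin awrites c ->
    (forall i s f, I i s -> I i (upd s x f)) ->
    I 0 s ->
    (forall i s1, i < m -> s1 x 0 = i ->
       (forall j, j \notin x :: awrites c -> s1 j = s j) -> I i s1 ->
       I i.+1 (run c s1)) ->
  I m (run (AFor x b c) s).
Proof.
move=> sb xc hI I0 IS; apply: run_for sb xc _ _; first exact: hI.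
by move=> i s1 im xi fr Ii; apply: hI; apply: IS.
Qed.

Definition lab s (j : nat) : 'I_n -> nat := fun v => s j v.
Definition decided s : pred 'I_n := fun v => s aDec v != 0.

(** These data live in arrays below 10, and the search writes only to arrays from 10 on. *)
Record ctx s : Prop := Ctx {
  ctxN : s aN 0 = n;
  ctxK : s aK 0 = k;
  ctxRow : forall u, u < n -> s aRow u = u * n;
  ctxD : s aD 0 = depth;
  ctxPow : s aPow 0 = 3 ^ depth;
  ctxMax : s aMax 0 = 3 ^ k * n.+1;
  ctxQuo : forall x, x < 3 ^ depth -> s aQuo x = x %/ 3;
  ctxRem : forall x, x < 3 ^ depth -> s aRem x = x %% 3;
  ctxTwo : s aTwo 0 = 2 }.

Lemma ctx_eq s s' : (forall j, j < 10 -> s' j = s j) -> ctx s -> ctx s'.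
Proof. by move=> e [*]; split; rewrite ?e //; move=> *; rewrite e // auto. Qed.

Lemma ctx_frame c s s' :
  all (leq 10) c -> (forall j, j \notin c -> s' j = s j) -> ctx s -> ctx s'.
Proof.
move=> /allP hc fr; apply: ctx_eq => j j10; apply: fr.
by apply/negP => /hc; rewrite leqNgt j10.
Qed.

Lemma ctx_run c s : all (leq 10) (awrites c) -> ctx s -> ctx (run c s).
Proof. by move=> hc; apply: ctx_frame hc _ => j; apply: run_frame. Qed.

Lemma adj_cellE s u v (hu : u < n) (hv : v < n) :
  adj_cell base inp s (u * n + v) = G (Ordinal hu) (Ordinal hv).
Proof.
rewrite -(inpE (Ordinal hu) (Ordinal hv)) /adj_cell ifT //.
have : (u.+1 * n <= n * n)%N by rewrite leq_mul2r hu orbT.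
by rewrite mulSn; lia.
Qed.

Definition last_candidate (l : 'I_n -> nat) (dec : pred 'I_n) : nat :=
  last_true (candidate G l dec) n.

Lemma run_pick s : ctx s ->
  run pick_cmd s aY 0 = last_candidate (lab s aLab) (decided s).
Proof.
move=> cs; rewrite /pick_cmd run_seq; set s0 := run _ s.
have n0 : s0 aN 0 = n by apply: ctxN cs.
have c0 : ctx s0 by apply: ctx_run cs.
pose P := candidate G (lab s aLab) (decided s).
apply: (run_forI (I := fun i s' => s' aY 0 = last_true P i) n0) => //.
move=> i s1 hi xi fr Ii.
have e10 : s1 aLab = s aLab by rewrite fr.
have e11 : s1 aDec = s aDec by rewrite fr.
have n1 : s1 aN 0 = n by rewrite fr // n0.
have c1 : ctx s1 by apply: ctx_frame fr c0.
pose Q := fun u : 'I_n => [&& s aDec u != 0, s aLab u == s aLab i & G u (Ordinal hi)].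
have PE : P (Ordinal hi) = (s aDec i == 0) && ((s aLab i == 2) || [exists u, Q u]).
  by rewrite /P /candidate negbK.
rewrite (last_trueS P hi) PE run_if /= xi e11.
case: (s aDec i == 0); last by [].
rewrite [_ != 0]/= run_if /= xi e10; case: (s aLab i == 2); first by rewrite run_store /= xi.
rewrite /= -(exists_ltn Q).
apply: (run_forI (I := fun j s' => s' aY 0 =
   if [exists u : 'I_n, (u < j) && Q u] then i else last_true P i) n1) => //.
  by rewrite exists_lt0.
move=> j s2 hj xj fr2 Ij.
have e10' : s2 aLab = s aLab by rewrite fr2 //= e10.
have e11' : s2 aDec = s aDec by rewrite fr2 //= e11.
have e31 : s2 aI 0 = i by rewrite fr2.
rewrite run_if /= xj e31 e10' e11' fr2 // (ctxRow c1 hj).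
rewrite (adj_cellE _ hj hi) (exists_ltS Q hj) /Q /=.
case: (s aDec j == 0) => /=; first by rewrite orbF.
case: (s aLab j == s aLab i) => /=; last by rewrite orbF.
case: (G _ _) => /=; last by rewrite orbF.
by rewrite run_store /= e31 orbT.
Qed.

Lemma run_decide e s : ctx s ->
  lab (run (decide_cmd e) s) aLab =
    (fun v => if v == s aY 0 :> nat then aeval s e else lab s aLab v) /\
  decided (run (decide_cmd e) s) =
    (fun v => (v == s aY 0 :> nat) || decided s v).
Proof.
move=> cs; rewrite /decide_cmd run_if /= (ctxN cs).
case: ltnP => [yn|ny]; last first.
  have ny' (v : 'I_n) : (v == s aY 0 :> nat) = false.
    by apply/negbTE; rewrite neq_ltn (leq_trans (ltn_ord v) ny).
  by split; apply: functional_extensionality => v; rewrite ny'.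
by split; apply: functional_extensionality => v;
   rewrite /lab /decided run_seq !run_store /=; case: (v == _ :> nat).
Qed.

Definition explore_step (p : ('I_n -> nat) * pred 'I_n) (g : nat) :
    ('I_n -> nat) * pred 'I_n :=
  let y := last_candidate p.1 p.2 in
  (fun v : 'I_n => if v == y :> nat then g else p.1 v,
   fun v : 'I_n => (v == y :> nat) || p.2 v).

Fixpoint explore (t x : nat) (p : ('I_n -> nat) * pred 'I_n) :=
  if t is t'.+1 then explore t' (x %/ 3) (explore_step p (x %% 3)) else p.

Lemma run_explore s : ctx s -> s aE 0 < 3 ^ depth ->
  (lab (run explore_cmd s) aLab, decided (run explore_cmd s)) =
  explore depth (s aE 0) (lab s aLab, decided s).
Proof.
move=> cs he; rewrite /explore_cmd run_seq; set s0 := run _ s.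
have c0 : ctx s0 by apply: ctx_run cs.
set p := RHS; move: (ctxD c0) => d0.
(* Written with [depth - depth] to be the invariant after the last round: the remaining steps lead
   from the current state and code to the fixed result [p]. *)
suff [_] : run (AFor aT aD (pick_cmd ;; decide_cmd (EA aRem (EV aCode)) ;;
      ASet aCode (EA aQuo (EV aCode)))) s0 aCode 0 < 3 ^ depth /\
    explore (depth - depth) (run (AFor aT aD (pick_cmd ;;
      decide_cmd (EA aRem (EV aCode)) ;; ASet aCode (EA aQuo (EV aCode)))) s0 aCode 0)
      (lab (run (AFor aT aD (pick_cmd ;; decide_cmd (EA aRem (EV aCode)) ;;
        ASet aCode (EA aQuo (EV aCode)))) s0) aLab,
       decided (run (AFor aT aD (pick_cmd ;; decide_cmd (EA aRem (EV aCode)) ;;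
        ASet aCode (EA aQuo (EV aCode)))) s0)) = p.
  by rewrite subnn.
apply: (run_forI (I := fun i s' => s' aCode 0 < 3 ^ depth /\
  explore (depth - i) (s' aCode 0) (lab s' aLab, decided s') = p) d0) => //.
  by rewrite subn0.
move=> i s1 hi _ fr [lt1 <-].
have c1 : ctx s1 by apply: (ctx_frame _ fr c0).
rewrite !run_seq; set s2 := run pick_cmd s1; set s3 := run (decide_cmd _) s2.
have c2 : ctx s2 by apply: ctx_run c1.
have y2 : s2 aY 0 = last_candidate (lab s1 aLab) (decided s1) by apply: run_pick.
have [l3 d3] := run_decide (EA aRem (EV aCode)) c2.
have f2 j : j \notin awrites pick_cmd -> s2 j = s1 j by apply: run_frame.
have f3 j : j \notin awrites pick_cmd -> j \notin [:: aLab; aDec] -> s3 j = s1 j.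
  by move=> h1 h2; rewrite /s3 run_frame ?f2.
rewrite run_store /= f3 // f3 // (ctxQuo c1 lt1); split.
  by apply: leq_ltn_trans lt1; apply: leq_div.
rewrite -[in RHS](subnSK hi) /= /explore_step /=; congr explore.
have -> : lab (upd s3 aCode (upd1 (s1 aCode) 0 (s1 aCode 0 %/ 3))) aLab = lab s3 aLab by [].
have -> : decided (upd s3 aCode (upd1 (s1 aCode) 0 (s1 aCode 0 %/ 3))) = decided s3 by [].
rewrite /s3 l3 d3 y2 /= f2 // f2 // (ctxRem c1 lt1).
by rewrite /lab /decided f2 // f2.
Qed.

Lemma run_check s : ctx s ->
  run check_cmd s aFlag 0 != 0 <->
  (forall u v, G u v -> lab s aLab u < 2 -> lab s aLab u <> lab s aLab v).
Proof.
move=> cs; rewrite /check_cmd run_seq; set s0 := run _ s.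
have c0 : ctx s0 by apply: ctx_run cs.
pose Q u v := [&& G u v, lab s aLab u < 2 & lab s aLab u == lab s aLab v].
have -> : run (AFor aI aN (AFor aJ aN (AWhen (EAnd (EAdjacent (EV aI) (EV aJ))
    (EAnd (ELt (EA aLab (EV aI)) (EC 2)) (EEq (EA aLab (EV aI)) (EA aLab (EV aJ)))))
    (ASet aFlag (EC 0))))) s0 aFlag 0 = ~~ [exists u : 'I_n, (u < n) && [exists v, Q u v]].
  apply: (run_forI (I := fun i s' => s' aFlag 0 =
    ~~ [exists u : 'I_n, (u < i) && [exists v, Q u v]]) (ctxN c0)) => //.
    by rewrite exists_lt0.
  move=> i s1 hi xi fr Ii.
  have c1 : ctx s1 by apply: (ctx_frame _ fr c0).
  rewrite (exists_ltS [pred u | [exists v, Q u v]] hi) /= -(exists_ltn (Q _)).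
  apply: (run_forI (I := fun j s' => s' aFlag 0 =
    ~~ ([exists u : 'I_n, (u < i) && [exists v, Q u v]] ||
        [exists v : 'I_n, (v < j) && Q (Ordinal hi) v])) (ctxN c1)) => //.
    by rewrite exists_lt0 orbF.
  move=> j s2 hj xj fr2 Ij.
  have c2 : ctx s2 by apply: (ctx_frame _ fr2 c1).
  have e31 : s2 aI 0 = i by rewrite fr2.
  have e10 : s2 aLab = s aLab by rewrite fr2 // fr.
  rewrite run_if /= xj e31 e10 (ctxRow c2 hi) (adj_cellE _ hi hj) (exists_ltS _ hj).
  have -> : Q (Ordinal hi) (Ordinal hj) =
    [&& G (Ordinal hi) (Ordinal hj), s aLab i < 2 & s aLab i == s aLab j] by [].
  clearbody Q.
  case: (G _ _) => /=; last by rewrite orbF.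
  case: (s aLab i < 2) => /=; last by rewrite orbF.
  case: (s aLab i == s aLab j) => /=; last by rewrite orbF.
  by rewrite run_store /= !orbT.
rewrite exists_ltn eqb0 negbK; split=> [/existsPn h u v uv ul|h].
  have /existsPn/(_ v) := h u; rewrite /Q uv ul /= => /eqP; exact.
apply/existsPn => u; apply/existsPn => v; apply/negP => /and3P[uv ul /eqP].
exact: h.
Qed.

Lemma run_count a s : ctx s -> a \notin [:: aCnt; aI] ->
  run (count_cmd a) s aCnt 0 = #|out (lab s a)|.
Proof.
rewrite !inE negb_or => cs /andP[a14 a31]; rewrite /count_cmd run_seq; set s0 := run _ s.
have c0 : ctx s0 by apply: ctx_run cs.
rewrite /out -card_ltn.
apply: (run_forI (I := fun i s' => s' aCnt 0 =
  #|[set v : 'I_n | (v < i) && (lab s a v == 2)]|) (ctxN c0)) => //.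
  by rewrite card_lt0.
move=> i s1 hi xi fr Ii; rewrite (card_ltS _ hi) run_if /= xi -Ii.
have -> : s1 a = s a by rewrite fr ?inE ?negb_or ?a14 ?a31 // /s0 run_frame // inE.
by rewrite /lab /=; case: (s a i == 2); rewrite //= addn0.
Qed.

Lemma run_copy a b s : ctx s -> a != aI -> b != aI -> a != b ->
  lab (run (copy_cmd a b) s) b = lab s a.
Proof.
move=> cs ai bi ab; apply: functional_extensionality => v; rewrite /lab.
suff : forall u, u < n -> run (copy_cmd a b) s b u = s a u by apply.
apply: (run_forI (I := fun i s' => forall u, u < i -> s' b u = s a u) (ctxN cs)) => //.
- by rewrite inE eq_sym.
- by move=> i s1 f h u hu; rewrite upd_neq ?h.
move=> i s1 hi xi fr Ii u; rewrite ltnS => ui; rewrite run_store /= xi eqxx.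
have -> : s1 a = s a by rewrite fr // !inE negb_or ai.
by rewrite /upd1; case: (u =P i) => [->//|/eqP ne]; apply: Ii; rewrite ltn_neqAle ne.
Qed.

(* Invariant of the attempt to put [w] back with label 0: if it succeeds at   *)
(* all, then every decided label is forced.                                   *)
Record forced (c : 'I_n -> nat) (w : 'I_n) (l : 'I_n -> nat) (dec : pred 'I_n) : Prop :=
  Forced {
  forced_out : forall v, (l v == 2) = (c v == 2) && (v != w);
  forced_le : forall v, l v <= 2;
  forced_dec : forall v, c v = 2 -> dec v;
  forced_guided : forall l1, valid G l1 -> out l1 = out c :\ w -> l1 w = 0 ->
    guided l1 c l dec }.

(** Oct vertices are decided, so [y] has a colour and a decided neighbour with the same one. That
    neighbour's label is forced, hence so is the other colour for [y]. *)
Lemma forced_step c w l dec y : c w = 2 -> forced c w l dec -> candidate G l dec y ->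
  forced c w (fun v => if v == y :> nat then 1 - l y else l v)
    (fun v => (v == y :> nat) || dec v).
Proof.
move=> cw [fo fl fd fg] /andP[dy hy].
have cy : (c y == 2) = false by apply: contraNF dy => /eqP/fd.
have ly : (l y == 2) = false by rewrite fo cy.
move: hy; rewrite ly /= => /existsP[u /and3P[du /eqP luy uy]].
split=> [v|v|v /fd ->|l1 p1 o1 w1 v]; last 2 first.
- by rewrite orbT.
- case: (v =P y :> nat) => [/val_inj ->|_]; last exact: fg.
  have g := fg l1 p1 o1 w1; have := g u; rewrite du => gu.
  have l1y : (l1 y == 2) = false.
    have : (y \in out l1) = (y \in out c :\ w) by rewrite o1.
    by rewrite !inE cy andbF.
  have ly2 : l y < 2 by have := fl y; move/eqP: (ly); lia.
  have := proj2 p1 _ _ uy; rewrite -gu luy => /(_ ly2).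
  by have := proj1 p1 y; move: l1y ly2; case: (l1 y) => [|[|[|]]] //; case: (l y) => [|[|]].
- case: (v =P y :> nat) => [/val_inj ->|_]; last exact: fo.
  by rewrite cy; case: (l y) => [|[|]].
by case: ifP => _; [lia|exact: fl].
Qed.

(** Each round decides a new vertex as long as there is a candidate. As [w] is decided at the start,
    [n] such rounds would decide more than [n] vertices. *)
Lemma run_propagate s w : ctx s -> lab s aCur w = 2 ->
    forced (lab s aCur) w (lab s aLab) (decided s) ->
  let s' := run propagate_cmd s in
  forced (lab s aCur) w (lab s' aLab) (decided s') /\
  forall y, ~~ candidate G (lab s' aLab) (decided s') y.
Proof.
move=> cs cw f0 s'.
suff [fs [//|]] : forced (lab s aCur) w (lab s' aLab) (decided s') /\
    ((forall y, ~~ candidate G (lab s' aLab) (decided s') y) \/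
     n < #|[set v | decided s' v]|).
  by have := max_card (mem [set v | decided s' v]); rewrite card_ord leqNgt => /negPf ->.
rewrite /s' /propagate_cmd.
apply: (run_forI (I := fun i t => forced (lab s aCur) w (lab t aLab) (decided t) /\
    ((forall y, ~~ candidate G (lab t aLab) (decided t) y) \/
     i < #|[set v | decided t v]|)) (ctxN cs)) => //.
  split=> //; right; rewrite card_gt0; apply/set0Pn; exists w.
  by rewrite inE (forced_dec f0).
move=> i s1 hi _ fr [f1 stop].
have c1 : ctx s1 by apply: (ctx_frame _ fr cs).
rewrite run_seq; set s2 := run pick_cmd s1.
have c2 : ctx s2 by apply: ctx_run c1.
have y2 : s2 aY 0 = last_candidate (lab s1 aLab) (decided s1) by apply: run_pick.
have [-> ->] := run_decide (ESub (EC 1) (EA aLab (EV aY))) c2.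
have -> : lab s2 aLab = lab s1 aLab by rewrite /lab /s2 run_frame.
have -> : decided s2 = decided s1 by rewrite /decided /s2 run_frame.
rewrite y2 /=.
have -> : s2 aLab = s1 aLab by rewrite /s2 run_frame.
rewrite y2 /last_candidate.
have [[y -> cy]|[-> nc]] := last_trueP (candidate G (lab s1 aLab) (decided s1)).
  split; first exact: forced_step.
  case: stop => [nc|lt_i]; first by have := nc y; rewrite cy.
  right; rewrite (cardsD1 y) !inE eqxx add1n ltnS.
  apply: leq_trans lt_i _; apply/subset_leq_card/subsetP => v; rewrite !inE => dv.
  rewrite dv orbT andbT; apply: contraTneq cy => <-.
  by rewrite /candidate dv.
have e1 : (fun v : 'I_n => if v == n :> nat then 1 - s1 aLab n else lab s1 aLab v) = lab s1 aLab.
  by apply: functional_extensionality => v; rewrite ltn_eqF.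
have e2 : (fun v : 'I_n => (v == n :> nat) || decided s1 v) = decided s1.
  by apply: functional_extensionality => v; rewrite ltn_eqF.
by rewrite e1 e2; split=> //; left.
Qed.

(** One pass suffices: the oct only shrinks, so a vertex that could not be put back never can be
    later. *)
Lemma run_extend s : ctx s -> valid G (lab s aCur) ->
  let s' := run extend_cmd s in
  [/\ valid G (lab s' aCur), out (lab s' aCur) \subset out (lab s aCur)
    & minimal_oct G (out (lab s' aCur))].
Proof.
move=> cs p0 s'.
suff [p' sub hmin] : [/\ valid G (lab s' aCur),
    out (lab s' aCur) \subset out (lab s aCur)
  & forall w : 'I_n, w < n -> w \in out (lab s' aCur) ->
      ~ oct G (out (lab s' aCur) :\ w)].
  split=> //; apply: minimal_octI; first exact: valid_oct.
  by move=> w; apply: hmin.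
rewrite /s' /extend_cmd.
apply: (run_forI (I := fun i t => [/\ valid G (lab t aCur),
    out (lab t aCur) \subset out (lab s aCur)
  & forall w : 'I_n, w < i -> w \in out (lab t aCur) ->
      ~ oct G (out (lab t aCur) :\ w)]) (ctxN cs)) => //.
move=> i s1 hi xi fr [p1 sub1 min1].
have c1 : ctx s1 by apply: (ctx_frame _ fr cs).
pose w := Ordinal hi.
rewrite run_if /= xi eqb0 negbK.
case: eqP => [cw|ncw]; last first.
  split=> // v; rewrite ltnS leq_eqVlt => /orP[/eqP vi|]; last exact: min1.
  by rewrite inE (_ : v = w) ?(introF eqP ncw) //; apply: val_inj.
rewrite run_seq; set s2 := run (AFor _ _ _) s1.
have c2 : ctx s2 by apply: ctx_run c1.
have init v : v < n -> s2 aLab v = s1 aCur v /\ s2 aDec v = (s1 aCur v == 2).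
  move: v; apply: (run_forI (I := fun j t => forall v, v < j ->
    t aLab v = s1 aCur v /\ t aDec v = (s1 aCur v == 2)) (ctxN c1)) => //.
  move=> j t hj xj frt It v; rewrite ltnS run_seq !run_store /= xj frt // => vj.
  by case: (v =P j) => [->//|/eqP ne]; apply: It; rewrite ltn_neqAle ne.
rewrite run_seq; set s3 := run (AStore _ _ _) s2.
have c3 : ctx s3 by apply: ctx_run c2.
have cur3 : s3 aCur = s1 aCur by rewrite /s3 run_frame // /s2 run_frame.
have lab3 v : lab s3 aLab v = if v == w then 0 else lab s1 aCur v.
  have v2 : s2 aV 0 = i by rewrite /s2 run_frame.
  rewrite /lab /s3 run_store /= v2.
  by rewrite -val_eqE /=; case: ifP => // _; have [] := init v (ltn_ord v).
have dec3 v : decided s3 v = (s1 aCur v == 2).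
  rewrite /decided /s3 run_frame //; have [_ ->] := init v (ltn_ord v).
  by case: (s1 aCur v == 2).
have f3 : forced (lab s3 aCur) w (lab s3 aLab) (decided s3).
  rewrite /lab cur3 -/(lab s1 aCur); split=> [v|v|v cv|l1 pl1 o1 w1 v].
  - by rewrite -/(lab s3 aLab v) lab3; case: (v == w); rewrite /= ?andbF ?andbT.
  - by rewrite -/(lab s3 aLab v) lab3; case: (v == w) => //; apply: (proj1 p1).
  - by rewrite dec3; apply/eqP.
  rewrite -/(lab s3 aLab v) lab3 dec3; case: (v =P w) => [->|/eqP vw].
    by rewrite cw eqxx w1.
  case: (s1 aCur v =P 2) => // cv; rewrite /lab cv.
  have : v \in out l1 by rewrite o1 !inE vw /lab cv.
  by rewrite inE => /eqP.
have cw3 : lab s3 aCur w = 2 by rewrite /lab cur3.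
have [f4 nc4] := run_propagate c3 cw3 f3.
rewrite run_seq; set s4 := run propagate_cmd s3 in f4 nc4 *.
have c4 : ctx s4 by apply: ctx_run c3.
have cur4 : s4 aCur = s1 aCur by rewrite /s4 run_frame.
rewrite run_seq; set s5 := run check_cmd s4.
have c5 : ctx s5 by apply: ctx_run c4.
have lab5 : lab s5 aLab = lab s4 aLab by rewrite /lab /s5 run_frame.
have cur5 : lab s5 aCur = lab s1 aCur by rewrite /lab /s5 run_frame // cur4.
have := run_check c4; rewrite -/s5 => flagE.
have out4 : out (lab s4 aLab) = out (lab s1 aCur) :\ w.
  by apply/setP => v; rewrite !inE (forced_out f4) /lab cur3 andbC.
rewrite run_if /=; case: ifP => flag.
  have -> : lab (run (copy_cmd aLab aCur) s5) aCur = lab s4 aLab.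
    by rewrite run_copy // lab5.
  have p4 : valid G (lab s4 aLab).
    by split; [apply: (forced_le f4)|apply: flagE.1].
  have sub41 : out (lab s4 aLab) \subset out (lab s1 aCur).
    by rewrite out4 subsetDl.
  split=> //; first exact: subset_trans sub41 sub1.
  move=> v; rewrite ltnS leq_eqVlt => /orP[/eqP vi|vi vo oc].
    by rewrite out4 (_ : v = w) ?inE ?eqxx //; apply: val_inj.
  apply: (min1 v vi); first exact: subsetP sub41 _ vo.
  by apply: oct_sub oc; apply: setSD.
rewrite cur5; split=> // v; rewrite ltnS leq_eqVlt => /orP[/eqP vi _|]; last exact: min1.
rewrite (_ : v = w); last exact: val_inj.
(* Suppose that [w] could be put back after all. A labelling doing so with colour 0 on [w] guides
   the propagation, whose result is then valid, against the failed check. *)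
move=> /oct_labelling-/(_ w)[l1 [pl1 o1 w1]].
have g : guided l1 (lab s3 aCur) (lab s4 aLab) (decided s4).
  apply: (forced_guided f4) => //; first by rewrite o1 /lab cur3.
  by apply: w1; rewrite !inE eqxx.
have p3 : valid G (lab s3 aCur) by rewrite /lab cur3.
have [p4 _] := guided_final pl1 p3 g nc4.
by move: flag; rewrite flagE.2 //; apply: (proj2 p4).
Qed.

Lemma explore_stuck t l dec : (forall y, ~~ candidate G l dec y) ->
  explore t 0 (l, dec) = (l, dec).
Proof.
move=> nc; elim: t => //= t IH.
have [[y _ cy]|[pn _]] := last_trueP (candidate G l dec).
  by have := nc y; rewrite cy.
have -> : explore_step (l, dec) (0 %% 3) = (l, dec); last exact: IH.
by rewrite /explore_step /last_candidate /= pn; congr pair;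
   apply: functional_extensionality => v; rewrite ltn_eqF.
Qed.

(** The digits are the labels of [l1]. Each step decides one more vertex of [changes l1 l2], so
    candidates run out within [t] steps; the remaining digits are set to 0. *)
Lemma explore_reaches l1 l2 t l dec :
    valid G l1 -> valid G l2 -> guided l1 l2 l dec ->
    (forall v, dec v -> v \in changes l1 l2) ->
    #|changes l1 l2| < #|[set v | dec v]| + t ->
  exists2 x, x < 3 ^ t &
    let l' := (explore t x (l, dec)).1 in valid G l' /\ out l' \subset out l1.
Proof.
move=> p1 p2; elim: t l dec => [|t IH] l dec g sub lt_t.
  move: lt_t; rewrite addn0 ltnNge subset_leq_card //.
  by apply/subsetP => v; rewrite inE; apply: sub.
have [[y py cy]|[pn nc]] := last_trueP (candidate G l dec); last first.
  exists 0; first by rewrite expn_gt0.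
  by rewrite explore_stuck //; apply: guided_final g nc.
have ych := candidate_changes p1 g cy.
have ndy : ~~ dec y by case/andP: cy.
pose l' := fun v : 'I_n => if v == y :> nat then l1 y else l v.
pose dec' := fun v : 'I_n => (v == y :> nat) || dec v.
have [|||x x3 hx] := IH l' dec'.
- move=> v; rewrite /l' /dec'; case: (v =P y :> nat) => [/val_inj->//|_]; exact: g.
- by move=> v /orP[/eqP/val_inj->//|]; apply: sub.
- apply: leq_trans lt_t _; rewrite addnS -addSn leq_add2r.
  apply: leq_trans (_ : #|y |: [set v | dec v]| <= _); first by rewrite cardsU1 inE ndy.
  by apply/subset_leq_card/subsetP => v; rewrite !inE -val_eqE.
have ly3 : l1 y < 3 by rewrite ltnS; apply: (proj1 p1).
exists (l1 y + x * 3); first by rewrite expnS; lia.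
rewrite [explore _ _ _]/=.
have -> : (l1 y + x * 3) %/ 3 = x by rewrite addnC divnMDl // divn_small // addn0.
rewrite (_ : explore_step _ _ = (l', dec')) //.
rewrite /explore_step /last_candidate py /l' /dec' /=.
by rewrite addnC modnMDl modn_small.
Qed.

Lemma run_swap s (x : 'I_n) : ctx s -> valid G (lab s aSaved) ->
    s aX 0 = x -> s aA 0 < 2 -> lab s aSaved x = 2 ->
  let s' := run swap_cmd s in
  valid G (lab s' aCur) /\ swap_of G (lab s aSaved) x (s aA 0) (lab s' aCur).
Proof.
move=> cs ps sx sa lx s'.
pose l := lab s aSaved; pose a := s aA 0.
have labE v : lab s' aCur v =
    if v == x then a else if G x v && (l v == a) then 2 else l v.
  rewrite /s' /swap_cmd run_seq; set s1 := run _ s.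
  rewrite run_store /lab /= {1}/s1 run_frame // sx -val_eqE.
  case: ifP => _; first by rewrite /s1 run_frame.
  suff H u : u < n -> forall hu : u < n,
      s1 aCur u = if G x (Ordinal hu) && (s aSaved u == a) then 2 else s aSaved u.
    rewrite (H v (ltn_ord v) (ltn_ord v)); congr (if G x _ && _ then _ else _).
    exact: val_inj.
  move: u; apply: (run_forI (I := fun i t => forall u, u < i -> forall hu : u < n,
    t aCur u = if G x (Ordinal hu) && (s aSaved u == a) then 2 else s aSaved u)
      (ctxN cs)) => //.
  move=> i s2 hi xi fr Ii u; rewrite ltnS => ui hu.
  have c2 : ctx s2 by apply: (ctx_frame _ fr cs).
  have e16 : s2 aSaved = s aSaved by rewrite fr.
  have e35 : s2 aX 0 = x by rewrite fr.
  have e36 : s2 aA 0 = a by rewrite fr.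
  have adj : adj_cell base inp s2 (s2 aRow x + i) = G x (Ordinal hi).
    rewrite (ctxRow c2) // (adj_cellE _ (ltn_ord x) hi); congr (nat_of_bool (G _ _)).
    exact: val_inj.
  rewrite run_if /= xi e35 e16 e36 adj.
  case: (u =P i) => [eui|nui].
    subst u; rewrite (_ : Ordinal hu = Ordinal hi); last exact: val_inj.
    case: (G x _) => /=; last by rewrite run_store /= xi e16 eqxx.
    by case: (s aSaved i == a) => /=; rewrite run_store /= xi ?e16 eqxx.
  have ltui : u < i by rewrite ltn_neqAle ui andbT; apply/eqP.
  rewrite -(Ii u ltui hu).
  by case: ifP => _ /=; rewrite run_store /= xi (introF eqP nui).
have outE : swap_of G l x a (lab s' aCur).
  apply/subsetP => v; rewrite !inE labE.
  case: (v =P x) => [_|_]; first by rewrite /a; case: (s aA 0) sa => [|[|]].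
  by case: (G x v && (l v == a)); rewrite /= ?orbT ?orbF.
split=> //; split=> [v|u v uv ul]; rewrite ?labE.
  by case: ifP => _; [rewrite /a; lia|case: ifP => // _; apply: (proj1 ps)].
move: ul; rewrite !labE; case: (u =P x) => [ux|_].
  have -> : (v == x) = false.
    by apply: contraTF uv => /eqP->; rewrite ux edge_irr.
  rewrite -ux uv /= => _; case: (l v =P a) => [_|nl].
    by rewrite /a; move: sa; case: (s aA 0) => [|[|]].
  by move=> e; case: nl.
case: ifP => [//|nu] ul; case: (v =P x) => [vx|_].
  by move: nu; rewrite -vx edge_sym uv /= => /eqP.
case: ifP => [_|nv]; first by move=> e; rewrite e in ul.
exact: (proj2 ps _ _ uv).
Qed.

(** * The table of representatives *)

Definition rep s (r : nat) : 'I_n -> nat := fun v => s aRep (r * n + v).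

Lemma run_compare s r : ctx s -> s aOff2 0 = r * n ->
  let s' := run compare_cmd s in
  ((s' aEq 0 != 0) && (s' aC1 0 == s' aC2 0)) <->
  same_key (lab s aBase) (rep s r) (lab s aCur).
Proof.
move=> cs offE s'.
pose b := lab s aBase; pose c := lab s aCur.
pose Q v := (b v == 2) && (rep s r v != c v).
have [eqE c1E c2E] : [/\ s' aEq 0 = ~~ [exists v : 'I_n, (v < n) && Q v],
    s' aC1 0 = #|[set v : 'I_n | (v < n) && ((b v != 2) && (rep s r v == b v))]|
  & s' aC2 0 = #|[set v : 'I_n | (v < n) && ((b v != 2) && (c v == b v))]|].
  rewrite /s' /compare_cmd !run_seq; set s0 := run (ASet aC2 _) _.
  have c0 : ctx s0 by rewrite /s0; do 3 (apply: ctx_run; first by []).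
  apply: (run_forI (I := fun i t =>
   [/\ t aEq 0 = ~~ [exists v : 'I_n, (v < i) && Q v],
    t aC1 0 = #|[set v : 'I_n | (v < i) && ((b v != 2) && (rep s r v == b v))]|
  & t aC2 0 = #|[set v : 'I_n | (v < i) && ((b v != 2) && (c v == b v))]|]) (ctxN c0)) => //.
    by rewrite exists_lt0 !card_lt0.
  move=> i s1 hi xi fr [I1 I2 I3].
  rewrite (exists_ltS Q hi) !(card_ltS _ hi) -I2 -I3.
  have eb : s1 aBase = s aBase by rewrite fr.
  have er : s1 aRep = s aRep by rewrite fr.
  have ec : s1 aCur = s aCur by rewrite fr.
  have eo : s1 aOff2 0 = r * n by rewrite fr.
  have -> : Q (Ordinal hi) = (s aBase i == 2) && (s aRep (r * n + i) != s aCur i) by [].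
  have -> : b (Ordinal hi) = s aBase i by [].
  have -> : c (Ordinal hi) = s aCur i by [].
  have -> : rep s r (Ordinal hi) = s aRep (r * n + i) by [].
  rewrite run_if /= xi eb; case: (s aBase i == 2) => /=.
    rewrite !addn0 run_if /= xi er ec eo; case: (_ == s aCur i) => /=.
      by rewrite orbF; split.
    by rewrite run_store /= orbT; split.
  rewrite orbF run_seq; set s2 := run _ s1.
  have s2E : s2 aC1 0 = s1 aC1 0 + (s aRep (r * n + i) == s aBase i).
    rewrite /s2 run_if /= xi eb er eo; case: (_ == s aBase i) => /=; last by rewrite addn0.
    by rewrite run_store.
  have f2 j : j \notin [:: aC1] -> s2 j = s1 j by move=> h; rewrite /s2 run_frame.
  have -> : run (AWhen (EEq (EA aCur (EV aI)) (EA aBase (EV aI)))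
     (ASet aC2 (EAdd (EV aC2) (EC 1)))) s2 aC2 0 = s1 aC2 0 + (s aCur i == s aBase i).
    rewrite run_if /= !f2 // xi eb ec; case: (_ == s aBase i) => /=.
      by rewrite run_store /= f2.
    by rewrite addn0 -f2.
  by split=> //; rewrite run_frame // f2.
rewrite eqE c1E c2E exists_ltn !card_ltn eqb0 negbK.
split=> [/andP[/existsPn h /eqP e]|[h e]].
  split=> // v bv; have := h v; rewrite /Q /b bv eqxx /= negbK => /eqP; exact.
rewrite e eqxx andbT; apply/existsPn => v; rewrite /Q negb_and negbK -implybE.
by apply/implyP => /eqP/h ->.
Qed.

(** [table_base] is conditional because the first minimal oct may already be large; the table then
    stays empty. *)
Record table s : Prop := Table {
  table_end : s aEnd 0 = s aNrep 0 * n;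
  table_good : forall r, r < s aNrep 0 -> good G k (rep s r);
  table_uniq : forall r r', r < r' -> r' < s aNrep 0 ->
    ~ same_key (lab s aBase) (rep s r) (rep s r');
  table_base : 0 < s aNrep 0 -> #|out (lab s aBase)| < k }.

(** Ensures that loops up to [aMax] miss no entry. *)
Lemma table_bound s : table s -> s aNrep 0 <= 3 ^ k * n.+1.
Proof.
case=> _ tg tu tb; have [->//|pos] := posnP (s aNrep 0).
have := key_bound (tb pos) _ tu; rewrite card_ord; apply.
by move=> r v /tg[[]].
Qed.

Definition covered s (l : 'I_n -> nat) : Prop :=
  exists2 r, r < s aNrep 0 & same_key (lab s aBase) (rep s r) l.

Lemma run_lookup s : ctx s -> table s ->
  run lookup_cmd s aFound 0 != 0 <-> covered s (lab s aCur).
Proof.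
move=> cs ts; rewrite /lookup_cmd !run_seq; set s0 := run (ASet aOff2 _) _.
have c0 : ctx s0 by rewrite /s0; do 2 (apply: ctx_run; first by []).
set c := AFor _ _ _.
suff [_ ->] : run c s0 aOff2 0 = 3 ^ k * n.+1 * n /\ (run c s0 aFound 0 != 0 <->
   exists r, [/\ r < 3 ^ k * n.+1, r < s aNrep 0
     & same_key (lab s aBase) (rep s r) (lab s aCur)]).
  split=> [[r [_ h1 h2]]|[r h1 h2]]; exists r => //; split=> //.
  exact: leq_trans h1 (table_bound ts).
apply: (run_forI (I := fun i t => t aOff2 0 = i * n /\ (t aFound 0 != 0 <->
   exists r, [/\ r < i, r < s aNrep 0
     & same_key (lab s aBase) (rep s r) (lab s aCur)])) (ctxMax c0)) => //.
  by split=> //; split=> // -[r []].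
move=> i s1 hi xi fr [offE found].
have c1 : ctx s1 by apply: (ctx_frame _ fr c0).
have e19 : s1 aNrep 0 = s aNrep 0 by rewrite fr.
rewrite run_seq; set s2 := run _ s1.
have c2 : ctx s2 by apply: ctx_run c1.
have off2 : s2 aOff2 0 = i * n by rewrite /s2 run_frame.
rewrite run_store /= off2 (ctxN c2) mulSnr; split=> //.
suff -> : s2 aFound 0 != 0 <-> s1 aFound 0 != 0 \/ (i < s aNrep 0 /\
    same_key (lab s aBase) (rep s i) (lab s aCur)).
  rewrite found; split=> [[[r [ri h1 h2]]|[h1 h2]]|[r [ri h1 h2]]].
  - by exists r; rewrite ltnS ltnW.
  - by exists i; rewrite ltnS leqnn.
  - move: ri; rewrite ltnS leq_eqVlt => /orP[/eqP<-|ri]; first by right.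
    by left; exists r.
rewrite /s2 run_if /= e19 xi; case: ltnP => [inr|nri] /=; last first.
  by split=> [h|[]]; [left| |case].
have fcmp : lab s1 aBase = lab s aBase /\ lab s1 aCur = lab s aCur /\ rep s1 i = rep s i.
  by rewrite /lab /rep !fr.
have := run_compare c1 offE; rewrite fcmp.1 fcmp.2.1 fcmp.2.2.
rewrite run_seq; set s3 := run compare_cmd s1; cbv zeta => cmp.
have f3 : s3 aFound = s1 aFound by rewrite /s3 run_frame.
rewrite run_if /=; case: (boolP ((s3 aEq 0 != 0) && (s3 aC1 0 == s3 aC2 0))) cmp.
  move=> /andP[-> ->] [/(_ isT) key _] /=.
  by split=> // _; right.
move=> /negPf h [_ key].
have -> : ((s3 aEq 0 != 0) && ((s3 aC1 0 == s3 aC2 0 : nat) != 0) : nat) = 0.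
  by move: h; case: (s3 aC1 0 == s3 aC2 0); rewrite ?andbF ?andbT //= => ->.
rewrite /= -[run ASkip s3]/s3 f3.
by split=> [|[//|[_ /key]]]; [left|].
Qed.

Definition extends s s' : Prop :=
  [/\ s aNrep 0 <= s' aNrep 0, lab s' aBase = lab s aBase
    & forall r, r < s aNrep 0 -> rep s' r = rep s r].

Lemma extends_trans s1 s2 s3 : extends s1 s2 -> extends s2 s3 -> extends s1 s3.
Proof.
move=> [a1 b1 c1] [a2 b2 c2]; split; first exact: leq_trans a1 a2.
  by rewrite b2.
by move=> r hr; rewrite c2 ?c1 // (leq_trans hr).
Qed.

Lemma covered_extends s s' l : extends s s' -> covered s l -> covered s' l.
Proof.
move=> [a b c] [r hr key]; exists r; first exact: leq_trans hr a.
by rewrite b c.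
Qed.

Lemma run_insert s : ctx s -> table s -> good G k (lab s aCur) ->
    #|out (lab s aBase)| < k -> ~ covered s (lab s aCur) ->
  let s' := run insert_cmd s in
  [/\ table s', extends s s' & covered s' (lab s aCur)].
Proof.
move=> cs ts gc kb nc s'.
have endE := table_end ts.
pose m := s aNrep 0.
have [new old endE' nrepE] : [/\ forall v, v < n -> s' aRep (m * n + v) = s aCur v,
    forall x, x < m * n -> s' aRep x = s aRep x,
    s' aEnd 0 = m.+1 * n & s' aNrep 0 = m.+1].
  rewrite /s' /insert_cmd !run_seq; set s1 := run (AFor _ _ _) s.
  have c1 : ctx s1 by apply: ctx_run cs.
  have e20 : s1 aEnd 0 = m * n by rewrite /s1 run_frame.
  have e19 : s1 aNrep 0 = m by rewrite /s1 run_frame.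
  rewrite !run_store /= e20 (ctxN c1) e19 mulSnr addn1.
  suff [h1 h2] : (forall v, v < n -> s1 aRep (m * n + v) = s aCur v) /\
      (forall x, x < m * n -> s1 aRep x = s aRep x) by split.
  apply: (run_forI (I := fun i t => (forall v, v < i -> t aRep (m * n + v) = s aCur v) /\
      (forall x, x < m * n -> t aRep x = s aRep x)) (ctxN cs)) => //.
  move=> i s2 hi xi fr [I1 I2].
  have ee : s2 aEnd 0 = m * n by rewrite fr.
  have ec : s2 aCur = s aCur by rewrite fr.
  rewrite run_store /= xi ee ec; split=> [v|x xm].
    rewrite ltnS eqn_add2l => vi.
    by case: (v =P i) => [->//|/eqP ne]; apply: I1; rewrite ltn_neqAle ne.
  by rewrite ltn_eqF ?I2 // ltn_addr.
have base' : lab s' aBase = lab s aBase by rewrite /lab /s' run_frame.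
have repN : rep s' m = lab s aCur.
  by apply: functional_extensionality => v; rewrite /rep new.
have repO r : r < m -> rep s' r = rep s r.
  move=> rm; apply: functional_extensionality => v; rewrite /rep old //.
  have : r.+1 * n <= m * n by rewrite leq_mul2r rm orbT.
  by rewrite mulSn; have := ltn_ord v; lia.
split; last by exists m; rewrite ?nrepE // repN base'.
  split; rewrite ?nrepE // ?base' //.
    move=> r; rewrite ltnS leq_eqVlt => /orP[/eqP->|rm]; first by rewrite repN.
    by rewrite repO //; apply: table_good ts _ _.
  move=> r r' rr'; rewrite ltnS leq_eqVlt => /orP[/eqP e|rm].
    move: rr'; rewrite e => rm; rewrite repN repO // => key.
    by apply: nc; exists r.
  by rewrite !repO ?(ltn_trans rr') //; apply: table_uniq ts _ _ rr' rm.
by split; rewrite ?nrepE.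
Qed.

Lemma table_eq s s' : table s ->
  s' aEnd = s aEnd -> s' aNrep = s aNrep -> s' aRep = s aRep -> s' aBase = s aBase ->
  table s'.
Proof.
move=> [t1 t2 t3 t4] e1 e2 e3 e4.
by split; rewrite /lab /rep e2 ?e1 ?e3 ?e4.
Qed.

Lemma extends_eq s s' :
  s' aNrep = s aNrep -> s' aRep = s aRep -> s' aBase = s aBase -> extends s s'.
Proof. by move=> e1 e2 e3; split; rewrite /lab /rep ?e1 ?e2 ?e3. Qed.

(** The last premise is trivial for the first oct, which is the base itself; later on the base is
    known to be small. *)
Lemma run_record s : ctx s -> table s -> valid G (lab s aCur) ->
    minimal_oct G (out (lab s aCur)) ->
    (#|out (lab s aCur)| < k -> #|out (lab s aBase)| < k) ->
  let s' := run record_cmd s in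
  [/\ table s', extends s s' &
    (s' aAns 0 = s aAns 0 /\ good G k (lab s aCur) /\ covered s' (lab s aCur)) \/
    (s' aAns 0 = 1 /\ k <= #|out (lab s aCur)|)].
Proof.
move=> cs ts vc mc hb s'.
rewrite /s' /record_cmd run_seq; set s1 := run _ s.
have c1 : ctx s1 by apply: ctx_run cs.
have cntE : s1 aCnt 0 = #|out (lab s aCur)| by apply: run_count.
have f1 j : j \notin [:: aCnt; aI] -> s1 j = s j.
  by move=> h; rewrite /s1 run_frame //; move: h; rewrite !inE; lia.
have t1 : table s1 by apply: table_eq ts _ _ _ _; rewrite f1.
have x1 : extends s s1 by apply: extends_eq; rewrite f1.
have cur1 : lab s1 aCur = lab s aCur by rewrite /lab f1.
have base1 : lab s1 aBase = lab s aBase by rewrite /lab f1.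
rewrite run_if /= cntE (ctxK c1); case: ltnP => small /=; last first.
  rewrite run_store; split.
  - by apply: table_eq t1 _ _ _ _.
  - by apply: extends_trans x1 _; apply: extends_eq.
  - by right.
have gc : good G k (lab s aCur) by [].
rewrite run_seq; set s2 := run lookup_cmd s1.
have c2 : ctx s2 by apply: ctx_run c1.
have t2 : table s2 by apply: table_eq t1 _ _ _ _; rewrite /s2 run_frame.
have x2 : extends s s2.
  by apply: extends_trans x1 _; apply: extends_eq; rewrite /s2 run_frame.
have cur2 : lab s2 aCur = lab s aCur by rewrite -cur1 /lab /s2 run_frame.
have base2 : lab s2 aBase = lab s aBase by rewrite -base1 /lab /s2 run_frame.
have ans2 : s2 aAns 0 = s aAns 0 by rewrite /s2 run_frame // f1.
have := run_lookup c1 t1; rewrite -/s2 cur1 => found.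
have cov12 l : covered s2 l -> covered s1 l.
  have e19 : s2 aNrep = s1 aNrep by rewrite /s2 run_frame.
  have e18 : s2 aRep = s1 aRep by rewrite /s2 run_frame.
  by case=> r; rewrite e19 base2 -base1 /rep e18; exists r.
have cov21 l : covered s1 l -> covered s2 l.
  by apply: covered_extends; apply: extends_eq; rewrite /s2 run_frame.
rewrite run_if /=; case f: (s2 aFound 0 == 0) => /=; last first.
  by split=> //; left; split=> //; split=> //; apply: cov21; apply/found; rewrite f.
have nc : ~ covered s2 (lab s2 aCur).
  by rewrite cur2 => /cov12/found; rewrite f.
have g2 : good G k (lab s2 aCur) by rewrite cur2.
have b2 : #|out (lab s2 aBase)| < k by rewrite base2; apply: hb.
have [t3 x3 cov3] := run_insert c2 t2 g2 b2 nc.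
split=> //; first exact: extends_trans x2 x3.
by left; rewrite run_frame // ans2 -{2}cur2; split.
Qed.

(** * Progress and soundness of the search *)

Definition progress s s' : Prop :=
  [/\ table s', extends s s', s' aAns 0 = 0 -> s aAns 0 = 0
    & s' aAns 0 != 0 -> s aAns 0 != 0 \/ max_min_oct G k].

Lemma progress_refl s : table s -> progress s s.
Proof. by move=> ts; split=> //; left. Qed.

Lemma progress_trans s1 s2 s3 : progress s1 s2 -> progress s2 s3 -> progress s1 s3.
Proof.
move=> [_ x12 z12 n12] [t3 x23 z23 n23]; split=> //.
- exact: extends_trans x12 x23.
- by move=> /z23/z12.
by move=> /n23[/n12|]; [|right].
Qed.

Lemma progress_eq s s' : table s ->
  s' aEnd = s aEnd -> s' aNrep = s aNrep -> s' aRep = s aRep -> s' aBase = s aBase ->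
  s' aAns = s aAns -> progress s s'.
Proof.
move=> ts e1 e2 e3 e4 e5; split; rewrite ?e5 //; last by left.
  exact: table_eq ts e1 e2 e3 e4.
exact: extends_eq.
Qed.

Lemma progress_upd s s' x f : x \notin [:: aEnd; aNrep; aRep; aBase; aAns] ->
  progress s s' -> progress s (upd s' x f).
Proof.
rewrite !inE !negb_or => /and5P[h1 h2 h3 h4 h5] p; apply: progress_trans (p) _.
by case: p => ts _ _ _; apply: progress_eq ts _ _ _ _ _; rewrite upd_neq // eq_sym.
Qed.

Definition swapped s (l : 'I_n -> nat) (x : 'I_n) (a : nat) : Prop :=
  exists l', [/\ good G k l', swap_of G l x a l' & covered s l'].

Lemma swapped_extends s s' l x a : extends s s' -> swapped s l x a -> swapped s' l x a.
Proof. by move=> h [l' [g sw c]]; exists l'; split=> //; apply: covered_extends c. Qed.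

(** Minimising after the move only shrinks the oct, which preserves the inclusion [swap_of]. *)
Lemma run_visit s (x : 'I_n) : ctx s -> table s -> 0 < s aNrep 0 ->
    valid G (lab s aSaved) -> s aX 0 = x -> s aA 0 < 2 -> lab s aSaved x = 2 ->
  let s' := run (swap_cmd ;; extend_cmd ;; record_cmd) s in
  progress s s' /\ (s' aAns 0 = 0 -> swapped s' (lab s aSaved) x (s aA 0)).
Proof.
move=> cs ts pos vs sx sa lx s'; rewrite /s' run_seq (run_seq _ _ _ extend_cmd).
have [vsw sw] := run_swap cs vs sx sa lx.
set s1 := run swap_cmd s in vsw sw *.
have c1 : ctx s1 by apply: ctx_run cs.
have [v2 sub2 m2] := run_extend c1 vsw.
set s2 := run extend_cmd s1 in v2 sub2 m2 *.
have c2 : ctx s2 by apply: ctx_run c1.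
have f2 j : j \notin awrites swap_cmd -> j \notin awrites extend_cmd -> s2 j = s j.
  by move=> h1 h2; rewrite /s2 run_frame // /s1 run_frame.
have p2 : progress s s2 by apply: progress_eq => //; rewrite f2.
have t2 : table s2 by case: p2.
have base2 : #|out (lab s2 aBase)| < k by apply: table_base t2 _; rewrite f2.
have [t3 x3 res] := run_record c2 t2 v2 m2 (fun _ => base2).
case: res => [[ans [g3 cov]]|[ans big]]; split.
- by apply: progress_trans p2 _; split=> //; rewrite ans //; left.
- by move=> _; exists (lab s2 aCur); split=> //; apply: subset_trans sub2 sw.
- apply: progress_trans p2 _; split; [exact: t3|exact: x3|by rewrite ans|move=> _].
  by right; exists (out (lab s2 aCur)).
by rewrite ans.
Qed.

Lemma explore_le t x l dec : (forall v, l v <= 2) ->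
  forall v, (explore t x (l, dec)).1 v <= 2.
Proof.
elim: t x l dec => [|t IH] x l dec l2 //=; apply: IH => v.
by case: ifP => // _; rewrite -ltnS ltn_mod.
Qed.

(** What trying code [e] on representative [r] achieves when no large oct shows up. It persists, as
    entries of the table never change. *)
Definition stepped s (r e : nat) : Prop :=
  let l := (explore depth e (rep s r, fun _ => false)).1 in
  valid G l -> #|out l| < k ->
  forall x a, x \in out l -> a < 2 -> swapped s l x a.

Lemma stepped_extends s s' r e :
  extends s s' -> r < s aNrep 0 -> stepped s r e -> stepped s' r e.
Proof.
move=> h hr st; rewrite /stepped; have [_ _ ->//] := h.
by move=> vl sl x a xl a2; apply: swapped_extends h _; apply: st.
Qed.

Lemma run_load s r : ctx s -> s aOff 0 = r * n ->
  lab (run load_cmd s) aLab = rep s r /\ decided (run load_cmd s) = fun _ => false.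
Proof.
move=> cs off.
suff H v : v < n -> run load_cmd s aLab v = s aRep (r * n + v) /\ run load_cmd s aDec v = 0.
  split; apply: functional_extensionality => v; rewrite /lab /decided /rep;
    by have [h1 h2] := H v (ltn_ord v); rewrite ?h1 ?h2.
move: v; apply: (run_forI (I := fun i t => forall v, v < i ->
  t aLab v = s aRep (r * n + v) /\ t aDec v = 0) (ctxN cs)) => //.
move=> i s1 hi xi fr Ii v.
have e18 : s1 aRep = s aRep by rewrite fr.
have e21 : s1 aOff 0 = r * n by rewrite fr.
rewrite ltnS run_seq !run_store /= xi e18 e21 => vi.
by case: (v =P i) => [->//|/eqP ne]; apply: Ii; rewrite ltn_neqAle ne.
Qed.

Lemma run_expand s r : ctx s -> table s -> r < s aNrep 0 ->
    s aOff 0 = r * n -> s aE 0 < 3 ^ depth ->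
  let s' := run expand_cmd s in
  progress s s' /\ (s' aAns 0 = 0 -> stepped s' r (s aE 0)).
Proof.
move=> cs ts hr off he s'; rewrite /s' /expand_cmd run_seq.
have [lab1 dec1] := run_load cs off.
set s1 := run load_cmd s in lab1 dec1 *.
have c1 : ctx s1 by apply: ctx_run cs.
have e1 : s1 aE 0 = s aE 0 by rewrite /s1 run_frame.
have := run_explore c1; rewrite e1 => /(_ he).
rewrite run_seq; set s2 := run explore_cmd s1.
have c2 : ctx s2 by apply: ctx_run c1.
rewrite lab1 dec1 => /(congr1 fst)/=; set l := (explore _ _ _).1 => lab2.
have l2 v : l v <= 2.
  by apply: explore_le; case: (table_good ts hr) => -[].
rewrite run_seq; have := run_check c2; set s3 := run check_cmd s2; rewrite lab2 => flag.
have c3 : ctx s3 by apply: ctx_run c2.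
have lab3 : lab s3 aLab = l by rewrite -lab2 /lab /s3 run_frame.
rewrite run_seq; have := run_count c3 (isT : aLab \notin [:: aCnt; aI]).
set s4 := run (count_cmd aLab) s3; rewrite lab3 => cnt.
have c4 : ctx s4 by apply: ctx_run c3.
have f4 j : j \notin awrites load_cmd -> j \notin awrites explore_cmd ->
    j \notin awrites check_cmd -> j \notin awrites (count_cmd aLab) -> s4 j = s j.
  by move=> h1 h2 h3 h4; rewrite /s4 run_frame // /s3 run_frame // /s2 run_frame // /s1 run_frame.
have p4 : progress s s4 by apply: progress_eq => //; rewrite f4.
have [t4 x4 _ _] := p4.
have flag4 : s4 aFlag 0 = s3 aFlag 0 by rewrite /s4 run_frame.
rewrite run_if /= flag4 cnt (ctxK c4).
have repE t : extends s4 t -> rep t r = rep s r.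
  by move=> xt; have [_ _ ->//] := extends_trans x4 xt.
case: ifP => [ok|bad]; last first.
  split=> // _; rewrite /stepped repE // -/l => vl sl.
  by move: bad; rewrite flag.2 ?sl //; apply: (proj2 vl).
have [vl sl] : valid G l /\ #|out l| < k.
  move: ok; case f: (s3 aFlag 0 != 0) => //=; case: (#|out l| < k) => // _.
  by split=> //; split=> //; apply/flag.
rewrite run_seq; set s5 := run (copy_cmd aLab aSaved) s4.
have c5 : ctx s5 by apply: ctx_run c4.
have lab5 : lab s5 aSaved = l.
  by rewrite /s5 run_copy // -lab3 /lab /s4 run_frame.
have p5 : progress s4 s5 by apply: progress_eq => //; rewrite /s5 run_frame.
have [t5 x5 _ _] := p5.
set c := AFor aX aN _.
suff [p6 all6] : progress s5 (run c s5) /\ (run c s5 aAns 0 = 0 ->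
    forall x : 'I_n, x < n -> x \in out l -> forall a, a < 2 -> swapped (run c s5) l x a).
  split; first exact: progress_trans p4 (progress_trans p5 p6).
  move=> z; rewrite /stepped repE; first by move=> _ _ x a xl a2; apply: all6.
  by have [_ x6 _ _] := p6; apply: extends_trans x5 x6.
apply: (run_forI (I := fun i t => progress s5 t /\ (t aAns 0 = 0 ->
    forall x : 'I_n, x < i -> x \in out l -> forall a, a < 2 -> swapped t l x a))
  (ctxN c5)) => //.
- by move=> i t f [p h]; split; [exact: progress_upd|exact: h].
- by split; [exact: progress_refl|move=> _ x; rewrite ltn0].
move=> i s6 hi xi fr [p6 all6].
have c6 : ctx s6 by apply: (ctx_frame _ fr c5).
have e16 : lab s6 aSaved = l by rewrite -lab5 /lab fr.
have [t6 x6 _ _] := p6.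
have last_or (x : 'I_n) : x < i.+1 -> x < i \/ x = Ordinal hi.
  by rewrite ltnS leq_eqVlt => /orP[/eqP e|]; [right; apply: val_inj|left].
rewrite run_if /= xi -/(lab s6 aSaved (Ordinal hi)) e16.
case: (l (Ordinal hi) =P 2) => [li|nli] /=; last first.
  split=> // z x /last_or[|->]; first exact: all6.
  by rewrite inE => /eqP.
set c' := AFor aA aTwo _.
suff [p7 all7] : progress s6 (run c' s6) /\ (run c' s6 aAns 0 = 0 ->
    forall a, a < 2 -> swapped (run c' s6) l (Ordinal hi) a).
  split; first exact: progress_trans p6 p7.
  have [_ x7 z7 _] := p7.
  move=> z x /last_or[xlt xl a a2|-> _]; last exact: all7.
  by apply: swapped_extends x7 _; apply: all6 => //; apply: z7.
apply: (run_forI (I := fun j t => progress s6 t /\ (t aAns 0 = 0 ->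
    forall a, a < j -> swapped t l (Ordinal hi) a)) (ctxTwo c6)) => //.
- by move=> j t f [p h]; split; [exact: progress_upd|exact: h].
- by split; [exact: progress_refl|move=> _ x; rewrite ltn0].
move=> j s7 hj xj fr7 [p7 all7].
have c7 : ctx s7 by apply: (ctx_frame _ fr7 c6).
have e7 : lab s7 aSaved = l by rewrite -e16 /lab fr7.
have [t7 x7 _ _] := p7.
have pos7 : 0 < s7 aNrep 0.
  have [h _ _] := extends_trans x4 (extends_trans x5 (extends_trans x6 x7)).
  by apply: leq_trans h; apply: leq_trans hr.
have [||||p8 sw8] := run_visit c7 t7 pos7 _ (x := Ordinal hi).
- by rewrite e7.
- by rewrite fr7.
- by rewrite xj.
- by rewrite e7.
split; first exact: progress_trans p7 p8.
have [_ x8 z8 _] := p8.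
move=> z a; rewrite ltnS leq_eqVlt => /orP[/eqP->|aj].
  by rewrite -e7 -xj; apply: sw8.
by apply: swapped_extends x8 _; apply: all7 => //; apply: z8.
Qed.

(** A nonzero answer is witnessed by a minimal oct met on the way. If the answer is 0, every code
    has been tried on every representative, which yields the premises of [no_large_minimal_oct]. *)
Lemma run_main s : unbreakable G q k -> ctx s -> s aNrep 0 = 0 -> s aEnd 0 = 0 ->
    s aOff 0 = 0 -> s aAns 0 = 0 ->
  run main_cmd s aAns 0 != 0 <-> max_min_oct G k.
Proof.
move=> unb cs nrep0 end0 off0 ans0; rewrite /main_cmd run_seq.
set s1 := run (AFor _ _ _) s.
have c1 : ctx s1 by apply: ctx_run cs.
have cur1 v : lab s1 aCur v = 2.
  suff H u : u < n -> s1 aCur u = 2 by apply: H.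
  move: u; apply: (run_forI (I := fun i t => forall u, u < i -> t aCur u = 2) (ctxN cs)) => //.
  move=> i t hi xi _ Ii u; rewrite ltnS run_store /= xi => ui.
  by case: (u =P i) => // /eqP ne; apply: Ii; rewrite ltn_neqAle ne.
have v1 : valid G (lab s1 aCur) by split=> [v|u v _]; rewrite cur1.
rewrite run_seq; have [v2 _ m2] := run_extend c1 v1.
set s2 := run extend_cmd s1 in v2 m2 *.
have c2 : ctx s2 by apply: ctx_run c1.
rewrite run_seq; set s3 := run (copy_cmd aCur aBase) s2.
have c3 : ctx s3 by apply: ctx_run c2.
have base3 : lab s3 aBase = lab s2 aCur by rewrite /s3 run_copy.
have cur3 : lab s3 aCur = lab s2 aCur by rewrite /lab /s3 run_frame.
have f3 j : j \notin awrites (AFor aI aN (AStore aCur (EV aI) (EC 2))) ->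
    j \notin awrites extend_cmd -> j \notin awrites (copy_cmd aCur aBase) -> s3 j = s j.
  by move=> h1 h2 h3; rewrite /s3 run_frame // /s2 run_frame // /s1 run_frame.
have t3 : table s3 by split; rewrite ?f3 // ?nrep0 ?end0.
have v3 : valid G (lab s3 aCur) by rewrite cur3.
have m3 : minimal_oct G (out (lab s3 aCur)) by rewrite cur3.
rewrite run_seq; have [|t4 x4 res] := run_record c3 t3 v3 m3; first by rewrite cur3 base3.
set s4 := run record_cmd s3 in t4 x4 res *.
have c4 : ctx s4 by apply: ctx_run c3.
have base4 : lab s4 aBase = lab s2 aCur by have [_ -> _] := x4.
have off4 : s4 aOff 0 = 0 by rewrite /s4 run_frame // f3.
rewrite cur3 in res.
set c := AFor _ _ _; set s5 := run c s4.
have [p5 _ all5] : [/\ progress s4 s5, s5 aOff 0 = 3 ^ k * n.+1 * n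
  & s5 aAns 0 = 0 -> forall r, r < 3 ^ k * n.+1 -> r < s5 aNrep 0 ->
      forall e, e < 3 ^ depth -> stepped s5 r e].
  apply: (run_forI (I := fun i t => [/\ progress s4 t, t aOff 0 = i * n
    & t aAns 0 = 0 -> forall r, r < i -> r < t aNrep 0 ->
      forall e, e < 3 ^ depth -> stepped t r e]) (ctxMax c4)) => //.
  - by move=> i t f [p o h]; split; [exact: progress_upd|exact: o|exact: h].
  - by split; [exact: progress_refl| |move=> _ x; rewrite ltn0].
  move=> i s6 hi xi fr [p6 off6 all6].
  have c6 : ctx s6 by apply: (ctx_frame _ fr c4).
  have [t6 x6 _ _] := p6.
  rewrite run_seq; set s7 := run _ s6.
  have c7 : ctx s7 by apply: ctx_run c6.
  suff [p7 all7] : progress s6 s7 /\ (s7 aAns 0 = 0 -> forall r, r < i.+1 ->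
      r < s7 aNrep 0 -> forall e, e < 3 ^ depth -> stepped s7 r e).
    have [t7 x7 z7 n7] := p7.
    have off7 : s7 aOff 0 = i * n by rewrite /s7 run_frame.
    set s8 := run _ s7.
    have p8 : progress s7 s8 by apply: progress_eq => //; rewrite /s8 run_frame.
    have [_ x8 z8 _] := p8.
    split.
    - exact: progress_trans p6 (progress_trans p7 p8).
    - by rewrite /s8 run_store /= off7 (ctxN c7) mulSnr.
    move=> z r ri rn e he; have rn7 : r < s7 aNrep 0 by move: rn; rewrite /s8 run_frame.
    by apply: (stepped_extends x8 rn7); apply: all7 => //; apply: z8.
  rewrite /s7 run_if /= xi; case: ltnP => [inr|nri] /=; last first.
    split; first exact: progress_refl.
    move=> z r ri rn; apply: all6 => //.
    exact: leq_trans rn nri.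
  set c' := AFor aE _ _.
  suff [p7 all7] : progress s6 (run c' s6) /\ (run c' s6 aAns 0 = 0 ->
      forall e, e < 3 ^ depth -> stepped (run c' s6) i e).
    have [_ x7 z7 _] := p7.
    split=> // z r; rewrite ltnS leq_eqVlt => /orP[/eqP-> _|ri rn e he]; first exact: all7.
    have rn6 : r < s6 aNrep 0 by apply: leq_trans ri (ltnW inr).
    by apply: (stepped_extends x7 rn6); apply: all6 => //; apply: z7.
  apply: (run_forI (I := fun j t => progress s6 t /\ (t aAns 0 = 0 ->
      forall e, e < j -> stepped t i e)) (ctxPow c6)) => //.
  - by move=> j t f [p h]; split; [exact: progress_upd|exact: h].
  - by split; [exact: progress_refl|move=> _ x; rewrite ltn0].
  move=> j s8 hj xj fr8 [p8 all8].
  have c8 : ctx s8 by apply: (ctx_frame _ fr8 c6).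
  have [t8 x8 _ _] := p8.
  have inr8 : i < s8 aNrep 0 by have [h _ _] := x8; apply: leq_trans inr h.
  have off8 : s8 aOff 0 = i * n by rewrite fr8.
  have [|p9 st9] := run_expand c8 t8 inr8 off8; first by rewrite xj.
  split; first exact: progress_trans p8 p9.
  have [_ x9 z9 _] := p9.
  move=> z e; rewrite ltnS leq_eqVlt => /orP[/eqP->|ej]; first by rewrite -xj; apply: st9.
  by apply: (stepped_extends x9 inr8); apply: all8 => //; apply: z9.
have [t5 x5 z5 n5] := p5.
have ans3 : s3 aAns 0 = 0 by rewrite f3.
case: res => [[ans4 [g4 cov4]]|[ans4 big4]]; last first.
  split=> _; first by exists (out (lab s2 aCur)).
  by apply/eqP => /z5; rewrite ans4.
split=> [/n5[]//|big]; first by rewrite ans4 ans3.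
apply/eqP => z.
have base5 : lab s5 aBase = lab s2 aCur by have [_ -> _] := x5.
pose P l := exists2 r, r < s5 aNrep 0 & l = rep s5 r.
apply: (no_large_minimal_oct (k := k) (s := lab s2 aCur) (rep := P) _ _ big).
  exists (lab s2 aCur) => //.
  have [r hr key] := covered_extends x5 cov4; rewrite base5 in key.
  by exists (rep s5 r); first by exists r.
move=> l2 l1 [r hr ->] g1 key1.
have g2 := table_good t5 hr.
have v1' : valid G l1 by case: g1.
have v2' : valid G (rep s5 r) by case: g2.
have close : #|changes l1 (rep s5 r)| <= 4 * k + 2 * q.
  have [h1 h2] := key1.
  apply: close_of_same_key unb v2 v1' v2' _ _ _; [by case: g1|by case: g2|].
  by split=> // v /h1.
(* No vertex is decided yet, so the strict inequality asks for one step more than [4 * k + 2 * q]: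
   hence the [+ 1] in [depth]. *)
have [|||e he [vl sub]] := @explore_reaches l1 (rep s5 r) depth (rep s5 r) (fun _ => false) v1' v2'.
- by [].
- by [].
- by rewrite addn1 addnS ltnS; apply: leq_trans close _; rewrite leq_addl.
set l := (explore _ _ _).1 in vl sub.
have oe : out l = out l1.
  by case: g1 => _ m1 _; apply: minimal_oct_eq m1 (valid_oct vl) sub.
exists l; split=> // x a xl a2.
have rmax : r < 3 ^ k * n.+1 by apply: leq_trans hr (table_bound t5).
have [|l' [g' sw' cov']] := all5 z r rmax hr e he vl _ x a xl a2.
  by rewrite -/l oe; case: g1.
exists l'; split=> //.
have [r' hr' key'] := cov'; rewrite base5 in key'.
by exists (rep s5 r'); first by exists r'.
Qed.

End Program.

(** * Initialisation and running time *)

Notation aQ := 29 (only parsing).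
Notation aM := 30 (only parsing).

(** [aK] initially holds [k + n * n]. Once [aNN] has accumulated [n * n], a subtraction recovers
    [k]. *)
Definition rows_cmd : acmd :=
  AFor aI aN (AStore aRow (EV aI) (EV aNN) ;; ASet aNN (EAdd (EV aNN) (EV aN))) ;;
  ASet aK (ESub (EV aK) (EV aNN)) ;;
  ASet aD (EAdd (EAdd (EAdd (EV aK) (EV aK)) (EAdd (EV aK) (EV aK)))
             (EAdd (EAdd EQ EQ) (EC 1))) ;;
  ASet aPow (EC 1) ;;
  ASet aMax (EAdd (EV aN) (EC 1)) ;;
  ASet aTwo (EC 2).

Definition powers_cmd : acmd :=
  AFor aI aD (ASet aPow (EAdd (EV aPow) (EAdd (EV aPow) (EV aPow)))) ;;
  AFor aI aK (ASet aMax (EAdd (EV aMax) (EAdd (EV aMax) (EV aMax)))).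

(** Division is not primitive either: quotients and remainders by 3 are tabulated by counting. *)
Definition digits_cmd : acmd :=
  AFor aI aPow
    (AStore aQuo (EV aI) (EV aQ) ;; AStore aRem (EV aI) (EV aM) ;;
     AIf (EEq (EV aM) (EC 2))
       (ASet aM (EC 0) ;; ASet aQ (EAdd (EV aQ) (EC 1)))
       (ASet aM (EAdd (EV aM) (EC 1)))).

Section Setup.

Variables (base q k n : nat) (inp : nat -> nat).
Local Notation run := (run base q inp).
Local Notation depth := (4 * k + 2 * q + 1).
Implicit Types s : state.

Lemma run_rows s : s aN 0 = n -> s aK 0 = k + n * n -> s aNN 0 = 0 ->
  let s' := run rows_cmd s in
  (forall u, u < n -> s' aRow u = u * n) /\
  [/\ s' aN 0 = n, s' aK 0 = k, s' aD 0 = depth, s' aPow 0 = 1 &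
     s' aMax 0 = n.+1 /\ s' aTwo 0 = 2].
Proof.
move=> sn sk snn s'; rewrite /s' /rows_cmd run_seq; set s1 := run _ s.
have e0 : s1 aN 0 = n by rewrite /s1 run_frame.
have e1 : s1 aK 0 = k + n * n by rewrite /s1 run_frame.
have [e2 rows] : s1 aNN 0 = n * n /\ forall u, u < n -> s1 aRow u = u * n.
  apply: (run_forI (I := fun i t => t aNN 0 = i * n /\
    forall u, u < i -> t aRow u = u * n) sn) => //.
  move=> i t hi xi fr [I1 I2]; rewrite run_seq !run_store /= I1 xi fr // sn mulSnr.
  split=> // u; rewrite ltnS => ui; case: (u =P i) => [->//|/eqP ne].
  by apply: I2; rewrite ltn_neqAle ne.
rewrite !run_seq !run_store /= e0 e1 e2; split; first exact: rows.
by split=> //; lia.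
Qed.

Lemma run_powers s : s aD 0 = depth -> s aK 0 = k -> s aPow 0 = 1 -> s aMax 0 = n.+1 ->
  let s' := run powers_cmd s in s' aPow 0 = 3 ^ depth /\ s' aMax 0 = 3 ^ k * n.+1.
Proof.
move=> sd sk sp sm s'; rewrite /s' /powers_cmd run_seq; set s1 := run _ s.
have e1 : s1 aPow 0 = 3 ^ depth.
  apply: (run_forI (I := fun i t => t aPow 0 = 3 ^ i) sd) => //.
  by move=> i t _ _ _ It; rewrite run_store /= It expnS; lia.
split; first by rewrite run_frame.
have e2 : s1 aK 0 = k by rewrite /s1 run_frame.
apply: (run_forI (I := fun i t => t aMax 0 = 3 ^ i * n.+1) e2) => //.
  by rewrite /s1 run_frame // sm expn0 mul1n.
by move=> i t _ _ _ It; rewrite run_store /= It expnS; lia.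
Qed.

Lemma run_digits s m : s aPow 0 = m -> s aQ 0 = 0 -> s aM 0 = 0 ->
  let s' := run digits_cmd s in
  forall x, x < m -> s' aQuo x = x %/ 3 /\ s' aRem x = x %% 3.
Proof.
move=> sp sq sm s'.
suff [_ _ h] : [/\ s' aQ 0 = m %/ 3, s' aM 0 = m %% 3
  & forall x, x < m -> s' aQuo x = x %/ 3 /\ s' aRem x = x %% 3] by [].
apply: (run_forI (I := fun i t => [/\ t aQ 0 = i %/ 3, t aM 0 = i %% 3
  & forall x, x < i -> t aQuo x = x %/ 3 /\ t aRem x = x %% 3]) sp) => //.
move=> i t hi xi _ [I1 I2 I3]; rewrite !run_seq !run_store /= xi I1 I2.
rewrite run_if /= I2.
have h x : x < i.+1 -> (if x == i then i %/ 3 else t aQuo x) = x %/ 3 /\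
    (if x == i then i %% 3 else t aRem x) = x %% 3.
  by rewrite ltnS; case: (x =P i) => [->//|/eqP ne xi']; apply: I3; rewrite ltn_neqAle ne.
by case: (i %% 3 =P 2) => i3; rewrite /= ?run_seq ?run_store /= ?I1 ?I2; split=> //; lia.
Qed.

End Setup.

(** * Placing the arrays behind the input *)

Section Input.

Variables (q k n : nat) (G : sgraph 'I_n).

Definition adjacency (i : nat) : nat := input G k q i.+3.

Lemma adjacencyE (u v : 'I_n) : adjacency (u * n + v) = G u v.
Proof.
rewrite /adjacency /=; congr nat_of_bool; apply/existsP/idP => [[u' /existsP[v']]|uv].
  have n0 : 0 < n by apply: leq_ltn_trans (ltn_ord u).
  move=> /andP[/eqP e uv].
  have := congr1 (divn^~ n) e; have := congr1 (modn^~ n) e.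
  rewrite !modnMDl !divnMDl // !modn_small // !divn_small // !addn0 => /val_inj-> /val_inj->.
  exact: uv.
by exists u; apply/existsP; exists v; rewrite eqxx.
Qed.

Lemma adjacency_out i : n * n <= i -> adjacency i = 0.
Proof.
move=> hi; rewrite /adjacency /=; apply/eqP; rewrite eqb0; apply/existsP => -[u].
move=> /existsP[v /andP[/eqP e _]].
have : u.+1 * n <= n * n by rewrite leq_mul2r ltn_ord orbT.
by rewrite mulSn; have := ltn_ord v; lia.
Qed.

Lemma adjacency0 : adjacency 0 = 0.
Proof.
rewrite /adjacency /=; apply/eqP; rewrite eqb0; apply/existsP => -[u] /existsP[v] /andP[e].
apply/negP; rewrite (_ : v = u) ?edge_irr //; apply: val_inj.
move: e; rewrite eq_sym addn_eq0 muln_eq0 => /andP[/orP[/eqP u0|/eqP n0] /eqP v0].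
  by rewrite /= u0 v0.
by have := ltn_ord u; lia.
Qed.

(* Cell 3 holds the diagonal entry (0, 0) of the adjacency matrix, hence 0.   *)
(* It is free as a scratch cell while [n * n] is being added to cell 1.       *)
Definition locate_cmd : cmd :=
  Seq (Write (Const 3) (Read (Const 0)))
    (Seq (While (Read (Const 0))
            (Seq (Write (Const 1) (Add (Read (Const 1)) (Read (Const 3))))
                 (Write (Const 0) (Defs.Sub (Read (Const 0)) (Const 1)))))
      (Seq (Write (far_addr aN (Const 0)) (Read (Const 3)))
        (Seq (Write (far_addr aK (Const 0)) (Read (Const 1)))
             (Write (Const 3) (Const 0))))).

Definition start : state := fun j i =>
  if (j == 0) && (i == 0) then n else if (j == 1) && (i == 0) then k + n * n else 0.

Lemma exec_locate : exists t m,
  [/\ exec locate_cmd (input G k q) t m,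
      implements (k + n * n + 4) q adjacency m start & t <= 1000 * n.+1].
Proof.
pose inv i (m : memory) := [/\ m 0 = i, m 1 = k + (n - i) * n, m 3 = n, m 2 = q
  & forall x, 3 < x -> m x = input G k q x].
(* With [i] rounds to go, [n] has been added [n - i] times to cell 1. A round costs 16 and the
   failing test 3. *)
have loop i m : i <= n -> inv i m -> exists2 m', exec (While (Read (Const 0))
      (Seq (Write (Const 1) (Add (Read (Const 1)) (Read (Const 3))))
           (Write (Const 0) (Defs.Sub (Read (Const 0)) (Const 1))))) m (16 * i + 3) m'
    & inv 0 m'.
  elim: i m => [|i IH] m hi mi.
    by exists m => //; apply: exec_while_false; case: mi.
  case: (mi) => m0 m1 m3 m2 mx.
  set m' := update (update m 1 (m 1 + m 3)) 0 (m 0 - 1).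
  have [|m'' e'' i''] := IH m' (ltnW hi).
    split; rewrite /m' /update /=.
    - by rewrite m0 subn1.
    - by rewrite m1 m3 -addnA -mulSnr; congr (_ + _ * _); lia.
    - exact: m3.
    - exact: m2.
    - by case=> [|[|x]] // hx; rewrite /= mx.
  exists m'' => //.
  rewrite (_ : 16 * i.+1 + 3 = (2 + (7 + 6) + (16 * i + 3)).+1); last by lia.
  apply: exec_while_true e''; first by rewrite /= m0.
  apply: exec_seq; first exact: (exec_store m (Const 1)).
  exact: (exec_store (update m 1 (m 1 + m 3)) (Const 0)).
pose m1 := update (input G k q) 3 n.
have [|m2 e2 [h0 h1 h3 h2 hx]] := loop n m1 (leqnn n).
  split=> //; rewrite /m1 /update /=; first by rewrite subnn addn0.
  by case=> [|[|[|[|x]]]].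
rewrite subn0 in h1.
pose m3 := update m2 (k + n * n + 4) n.
pose m4 := update m3 (k + n * n + 5) (k + n * n).
pose m5 := update m4 3 0.
have far (m : memory) j : m 1 = k + n * n -> eval m (far_addr j (Const 0)) = k + n * n + 4 + j.
  by move=> e; rewrite /= e !addn0.
have e3 := exec_store m2 (far_addr aN (Const 0)) (Read (Const 3)).
have e4 := exec_store m3 (far_addr aK (Const 0)) (Read (Const 1)).
rewrite (far _ _ h1) [eval m2 (Read _)]/= h3 addn0 -/m3 in e3.
have m3_1 : m3 1 = k + n * n by rewrite /m3 /update ifF // addn4.
rewrite (far _ _ m3_1) [eval m3 (Read _)]/= m3_1 -addnA -/m4 in e4.
have e5 : exec (Write (Const 3) (Const 0)) m4 3 m5 by apply: exec_store.
have e1 : exec (Write (Const 3) (Read (Const 0))) (input G k q) 4 m1.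
  exact: (exec_store (input G k q) (Const 3)).
have e345 := exec_seq e3 (exec_seq e4 e5).
exists (4 + (16 * n + 3 + (((expr_cost (far_addr aN (Const 0)) + 2).+1 +
  ((expr_cost (far_addr aK (Const 0)) + 2).+1 + 3))))), m5; split.
- exact: exec_seq e1 (exec_seq e2 e345).
- have base1 x : x < 4 -> (x == k + n * n + 4) = false /\ (x == k + n * n + 5) = false.
    by move=> x4; split; apply/negbTE; rewrite neq_ltn; apply/orP; left; lia.
  split.
  + by rewrite /m5 /m4 /m3 /update /= (base1 0 isT).1 (base1 0 isT).2.
  + by rewrite /m5 /m4 /m3 /update /= (base1 1 isT).1 (base1 1 isT).2 h1.
  + by rewrite /m5 /m4 /m3 /update /= (base1 2 isT).1 (base1 2 isT).2.
  + move=> [|i] hi; first by rewrite adjacency0.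
    by rewrite /m5 /m4 /m3 /update /= !ifF ?hx //; lia.
  (* Array entries other than the two just written lie behind the adjacency matrix, where the input
     is 0. *)
  move=> j i hj; rewrite /start /m5 /m4 /m3 /update.
  rewrite ifF; last by lia.
  case: (j =P 0) => [->|j0] /=.
    rewrite ifF; last by lia.
    case: (i =P 0) => [->|i0] /=; first by rewrite ifT //; lia.
    rewrite ifF; last by lia.
    rewrite hx; last by lia.
    rewrite (_ : _ + _ = (k + n * n + 64 * i + 1).+3); last by lia.
    by apply: adjacency_out; lia.
  case: (j =P 1) => [->|j1] /=.
    case: (i =P 0) => [->|i0] /=; first by rewrite ifT //; lia.
    rewrite !ifF; [|lia|lia].
    rewrite hx; last by lia.
    rewrite (_ : _ + _ = (k + n * n + 64 * i + 2).+3); last by lia.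
    by apply: adjacency_out; lia.
  rewrite !ifF; [|lia|lia].
  rewrite hx; last by lia.
  rewrite (_ : _ + _ = (k + n * n + 64 * i + j + 1).+3); last by lia.
  by apply: adjacency_out; lia.
by rewrite [expr_cost _]/= [expr_cost (far_addr 1 _)]/=; lia.
Qed.

End Input.

(** * The whole program and its running time *)

Definition max_min_oct_cmd : cmd :=
  Seq locate_cmd
    (Seq (cmd_of rows_cmd) (Seq (cmd_of powers_cmd) (Seq (cmd_of digits_cmd)
      (Seq (cmd_of main_cmd) (Write (Const 0) (Read (far_addr aAns (Const 0)))))))).

Lemma exec_stage c d :
    wf_cmd c -> all (fun b => b \notin awrites c) (for_bounds c) -> for_depth c <= d ->
  exists z, forall X base q inp m s, implements base q inp m s ->
    all (fun b => s b 0 <= X) (for_bounds c) ->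
    exists t m', [/\ exec (cmd_of c) m t m', implements base q inp m' (run base q inp c s)
      & t <= z * X.+1 ^ d].
Proof.
move=> wc /allP bw dd; exists (size_cost c) => X base q inp m s ms /allP bX.
have [t [m' [e r l]]] := exec_cmd_of wc bw ms bX.
exists t, m'; split=> //; apply: leq_trans l _.
by rewrite leq_mul2l leq_pexp2l ?orbT.
Qed.

(* The exponent 8 is the nesting depth of the loops of [main_cmd].            *)
Lemma exec_max_min_oct : exists C, forall (q k n : nat) (G : sgraph 'I_n),
  unbreakable G q k ->
  exists t m, [/\ exec max_min_oct_cmd (input G k q) t m,
    t <= C * (3 ^ (5 * k + 2 * q + 1) * n.+1).+1 ^ 8 & accepting m <-> max_min_oct G k].
Proof.
have [z1 stage1] : exists z, _ := @exec_stage rows_cmd 8 isT isT isT.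
have [z2 stage2] : exists z, _ := @exec_stage powers_cmd 8 isT isT isT.
have [z3 stage3] : exists z, _ := @exec_stage digits_cmd 8 isT isT isT.
have [z4 stage4] : exists z, _ := @exec_stage main_cmd 8 isT isT isT.
have [z5 hz5] : exists z, expr_cost (far_addr aAns (Const 0)) = z by eexists.
have sub4 : all [in [:: aN; aD; aPow; aMax; aTwo]] (for_bounds main_cmd) by vm_compute.
exists (1000 + z1 + z2 + z3 + z4 + (1 + z5.+1).+1) => q k n G unb.
(* [X] dominates all loop bounds, in particular [3 ^ (4 * k + 2 * q + 1)] and the table size
   [3 ^ k * n.+1]. *)
set X := 3 ^ _ * _.
have inpE := @adjacencyE q k n G.
set base := k + n * n + 4.
have base_gt : n * n + 3 <= base by rewrite /base; lia.
have [t0 [m0 [e0 r0 l0]]] := exec_locate q k G.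
have pX y : 0 < y -> y <= 3 ^ (5 * k + 2 * q + 1) -> y <= X.
  by move=> _ h; apply: leq_trans h _; rewrite leq_pmulr.
have nX : n <= X by rewrite /X -[n in n <= _]mul1n leq_mul ?expn_gt0.
have pow_le y : y < 3 ^ y by apply: ltn_expl.
have powX y : y <= 5 * k + 2 * q + 1 -> 3 ^ y <= X.
  by move=> h; apply: pX; rewrite ?expn_gt0 ?leq_pexp2l.
have dX : 4 * k + 2 * q + 1 <= X.
  by apply: leq_trans (ltnW (pow_le _)) (powX _ _); lia.
have kX : k <= X by apply: leq_trans (ltnW (pow_le _)) (powX _ _); lia.
have pdX : 3 ^ (4 * k + 2 * q + 1) <= X by apply: powX; lia.
have twoX : 2 <= X.
  by apply: (leq_trans (isT : 2 <= 3 ^ 1)); apply: powX; lia.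
have maxX : 3 ^ k * n.+1 <= X by rewrite /X leq_mul2r leq_pexp2l ?orbT //; lia.
have [|t1 [m1 [e1 r1 l1]]] := stage1 X _ _ _ _ _ r0; first by rewrite /= nX.
have [rows [s1n s1k s1d s1p [s1m s1t]]] :=
  @run_rows base q k n (adjacency q k G) (start k n) erefl erefl erefl.
set s1 := run _ _ _ rows_cmd _ in r1 rows s1n s1k s1d s1p s1m s1t.
have zero1 j : j \notin awrites rows_cmd -> s1 j = start k n j.
  by move=> h; rewrite /s1 run_frame.
clearbody s1.
have [|t2 [m2 [e2 r2 l2]]] := stage2 X _ _ _ _ _ r1.
  by rewrite /= s1d s1k dX kX.
have [s2p s2m] := @run_powers base q k n (adjacency q k G) s1 s1d s1k s1p s1m.
set s2 := run _ _ _ powers_cmd _ in r2 s2p s2m.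
have zero2 j : j \notin awrites powers_cmd -> s2 j = s1 j.
  by move=> h; rewrite /s2 run_frame.
clearbody s2.
have [|t3 [m3 [e3 r3 l3]]] := stage3 X _ _ _ _ _ r2.
  by rewrite /= s2p pdX.
have q2 : s2 aQ 0 = 0 by rewrite zero2 // zero1.
have m2' : s2 aM 0 = 0 by rewrite zero2 // zero1.
have dig := @run_digits base q (adjacency q k G) s2 _ s2p q2 m2'.
set s3 := run _ _ _ digits_cmd _ in r3 dig.
have f3 j : j \notin awrites digits_cmd -> s3 j = s2 j.
  by move=> h; rewrite /s3 run_frame.
clearbody s3.
have c3 : ctx q k n s3.
  split; [by rewrite f3 // zero2|by rewrite f3 // zero2
    |by move=> u hu; rewrite f3 // zero2 // rows|by rewrite f3 // zero2
    |by rewrite f3|by rewrite f3| | |by rewrite f3 // zero2].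
  - by move=> x hx; have [] := dig x hx.
  by move=> x hx; have [] := dig x hx.
have [|t4 [m4 [e4 r4 l4]]] := stage4 X _ _ _ _ _ r3.
  apply: sub_all sub4 => b; rewrite !inE => /or4P[/eqP->|/eqP->|/eqP->|/orP[/eqP->|/eqP->]].
  - by rewrite (ctxN c3).
  - by rewrite (ctxD c3).
  - by rewrite (ctxPow c3).
  - by rewrite (ctxMax c3).
  by rewrite (ctxTwo c3).
have ans : run base q (adjacency q k G) main_cmd s3 aAns 0 != 0 <-> max_min_oct G k.
  by apply: (run_main inpE base_gt unb c3); rewrite f3 // zero2 // zero1.
set s4 := run _ _ _ main_cmd _ in r4 ans.
have v5 : eval m4 (Read (far_addr aAns (Const 0))) = s4 aAns 0.
  exact: (eval_expr_of r4 (e := EA aAns (EC 0))).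
have e5 : exec (Write (Const 0) (Read (far_addr aAns (Const 0)))) m4 (1 + z5.+1).+1
    (update m4 0 (s4 aAns 0)).
  by rewrite -v5 -hz5; apply: (exec_store m4 (Const 0)).
exists (t0 + (t1 + (t2 + (t3 + (t4 + (1 + z5.+1).+1))))),
  (update m4 0 (s4 aAns 0)); split; last by rewrite /accepting /update /=.
- exact: exec_seq e0 (exec_seq e1 (exec_seq e2 (exec_seq e3 (exec_seq e4 e5)))).
have nY : n.+1 <= X.+1 ^ 8.
  apply: leq_trans (_ : X.+1 ^ 1 <= _); first by rewrite expn1.
  by rewrite leq_pexp2l.
have l5 : (1 + z5.+1).+1 <= (1 + z5.+1).+1 * X.+1 ^ 8.
  by apply: leq_pmulr; rewrite expn_gt0.
have {}l0 : t0 <= 1000 * X.+1 ^ 8 by apply: leq_trans l0 _; rewrite leq_mul2l nY.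
by rewrite !mulnDl -!addnA; do ![apply: leq_add => //].
Qed.

Lemma expn_absorb c : exists a C, forall q k, 0 < q -> 0 < k ->
  2 ^ (c * (q * k)) <= C * 2 ^ ((q * k) ^ (a * q)).
Proof.
(* For [m = q * k] at least 2, [m ^ c.+1] is at least [2 ^ c * m], hence at least [c * m]. The
   factor [2 ^ c] covers [m = 1]. *)
exists c.+1, (2 ^ c) => q k q0 k0.
have : 0 < q * k by rewrite muln_gt0 q0.
move: (q * k) => m; case: m => [//|[|m]] _.
  by rewrite muln1 leq_pmulr // expn_gt0.
apply: leq_trans (_ : 2 ^ (m.+2 ^ (c.+1 * q)) <= _); last first.
  by rewrite leq_pmull // expn_gt0.
rewrite leq_pexp2l //; apply: leq_trans (_ : m.+2 ^ c.+1 <= _); last first.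
  by rewrite leq_pexp2l // leq_pmulr.
rewrite expnS mulnC leq_mul2l /=; apply: leq_trans (_ : 2 ^ c <= _).
  by apply: ltnW; apply: ltn_expl.
by case: (c) => [|c']; rewrite ?expn0 // leq_exp2r.
Qed.

Theorem theorem4 :
  exists (P : cmd) (C a b : nat),
  forall (q k n : nat) (G : sgraph 'I_n),
    0 < q -> 0 < k -> unbreakable G q k ->
    exists (t : nat) (m : memory),
      [/\ exec P (input G k q) t m,
          t <= C * 2 ^ ((q * k) ^ (a * q)) * n.+1 ^ b
        & accepting m <-> max_min_oct G k].
Proof.
(* 128 is 8 times 16: 8 is the exponent of the running time, and
   [2 * (5 * k + 2 * q + 1) <= 16 * (q * k)] for positive [q] and [k]. *)
have [C hC] := exec_max_min_oct; have [a [C' hC']] := expn_absorb 128.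
exists max_min_oct_cmd, (C * C'), a, 8 => q k n G q0 k0 unb.
have [t [m [ex ht acc]]] := hC q k n G unb.
exists t, m; split=> //; apply: leq_trans ht _; rewrite -!mulnA leq_mul2l mulnA.
apply/orP; right; apply: leq_trans (_ : 2 ^ (128 * (q * k)) * n.+1 ^ 8 <= _); last first.
  by rewrite leq_mul2r hC' ?orbT.
have -> : 128 * (q * k) = 16 * (q * k) * 8 by rewrite mulnAC.
rewrite expnM -expnMn leq_exp2r //.
set e := 5 * k + 2 * q + 1; have e0 : 0 < e by rewrite /e addn1.
apply: leq_trans (_ : 2 ^ (2 * e) * n.+1 <= _); last first.
  rewrite leq_mul2r leq_pexp2l ?orbT //.
  have h1 : q + k <= (q * k).+1 by nia.
  have h2 : k <= q * k by rewrite leq_pmull.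
  have h3 : 0 < q * k by rewrite muln_gt0 q0.
  by rewrite /e; lia.
(* As [e] is positive, [(3 ^ e).+1 <= 4 ^ e]. *)
rewrite expnM -[2 ^ 2]/4; apply: leq_trans (_ : (3 ^ e).+1 * n.+1 <= _).
  by rewrite mulSn -add1n leq_add2r.
by rewrite leq_mul2r orFb ltn_exp2r.
Qed.
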